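(* Let $(\bar x,\bar y)\in\Omega_{GE}$ and assume (see context for all notation): (1) the tangent cone $T_C(\bar x)$ is convex and $T_D(F(\bar x,\bar y))=T_C(\bar x)\times T_{{\rm gph}\,\widehat N_\Gamma}(\bar y,-G(\bar x,\bar y))$; (2) GGCQ holds at $(\bar x,\bar y)$; (3) there is some $v\in\mathbb{R}^m$ such that $\nabla g_i(\bar y)v<0$ for all $i\in\bar{\mathcal I}$ (MFCQ at $\bar y$); and in addition that $T_C(\bar x)$ is polyhedral and $\bar\Lambda(v_1)=\bar\Lambda(v_2)$ for all $0\ne v_1,v_2\in\bar K$. Let $\bar\lambda$ be an arbitrarily fixed multiplier from $\bar\Lambda(v)$ for some $0\ne v\in\bar K$ if $\bar K\ne\{0\}$, and $\bar\lambda\in\bar\Lambda$ otherwise. Assume that we are given a partition $(\beta_1,\beta_2)$ of $\bar I^0$ such that the following two conditions are fulfilled: (i) For every $j\in\beta_2$ there are $l^j\in{\rm lin}\, T_C(\bar x)$, reals $\tilde \alpha^j_i$, $i\in \bar I^+$, and $z^j\in\mathbb{R}^m$ with \begin{align*} &\nabla g_j(\bar y)-\sum_{i\in \bar I^+}\nabla g_i(\bar y)\tilde\alpha^j_i - \big(\nabla_y G(\bar x,\bar y)+\nabla^2(\bar\lambda^Tg)(\bar y)\big)z^j+\nabla_x G(\bar x,\bar y)l^j=0,\\ &\nabla g_i(\bar y)z^j=0,\ i\in\bar{\mathcal I}. \end{align*} (ii) For every $k\in\beta_1$ there are $l^k\in{\rm lin}\, T_C(\bar x)$, reals $\tilde \alpha^k_i$,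 $i\in \bar I^+$, and $z^k\in\mathbb{R}^m$ with \begin{align*} &\sum_{i\in \bar I^+}\nabla g_i(\bar y)\tilde\alpha^k_i+ \big(\nabla_y G(\bar x,\bar y)+\nabla^2(\bar\lambda^Tg)(\bar y)\big)z^k-\nabla_x G(\bar x,\bar y)l^k=0,\\ &\nabla g_i(\bar y)z^k=0,\ i\in\bar{\mathcal I} \setminus\{k\},\quad \nabla g_k(\bar y)z^k=-1. \end{align*} Then $$\widehat N_{\Omega_{GE}}(\bar x,\bar y)=M^{\beta_1,\beta_2}_{GE}=\nabla F(\bar x,\bar y)^T\widehat N_D(F(\bar x,\bar y)).$$
   Context: For $\Theta\subset\mathbb{R}^d$, $\bar z\in\Theta$: $T_\Theta(\bar z)=\{u\mid \exists t_k\searrow 0,\ u_k\to u:\ \bar z+t_ku_k\in\Theta\ \forall k\}$, $\widehat N_\Theta(\bar z)=(T_\Theta(\bar z))^\circ$, where $K^\circ=\{z^*\mid \langle z^*,u\rangle\le 0\ \forall u\in K\}$; $\widehat N_\Theta(\bar z)=\emptyset$ if $\bar z\notin\Theta$. Setting: $G:\mathbb{R}^n\times\mathbb{R}^m\to\mathbb{R}^m$ is continuously differentiable, $C\subset\mathbb{R}^n$ is closed, $g:\mathbb{R}^m\to\mathbb{R}^l$ is twice continuously differentiable, $\Gamma=\{y\in\mathbb{R}^m\mid g_i(y)\le 0,\ i=1,\ldots,l\}$, ${\rm gph}\,\widehat N_\Gamma=\{(y,y^* )\mid y^*\in\widehat N_\Gamma(y)\}$, and $$\Omega_{GE}=\{(x,y)\mid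 0\in G(x,y)+\widehat N_\Gamma(y),\ x\in C\}=\{(x,y)\mid F(x,y)\in D\},$$ with $F(x,y)=(x,(y,-G(x,y)))$, $D=C\times{\rm gph}\,\widehat N_\Gamma$. GGCQ at $(\bar x,\bar y)$: $(T_{\Omega_{GE}}(\bar x,\bar y))^\circ=\{(u,v)\mid\nabla F(\bar x,\bar y)(u,v)\in T_D(F(\bar x,\bar y))\}^\circ$. Notation: $\bar y^*=-G(\bar x,\bar y)$; $\bar{\mathcal I}=\{i\mid g_i(\bar y)=0\}$; $\bar\Lambda=\{\lambda\in\widehat N_{\mathbb{R}^l_-}(g(\bar y))\mid\nabla g(\bar y)^T\lambda=\bar y^*\}$; $\bar K=T_\Gamma(\bar y)\cap(\bar y^* )^\perp$; $I^+(\lambda)=\{i\mid\lambda_i>0\}$; $\bar I^+=\bigcup_{\lambda\in\bar\Lambda}I^+(\lambda)$; $\bar I^0=\bar{\mathcal I}\setminus\bar I^+$; for $v\in\bar K$, $\bar\Lambda(v)=\mathop{\rm arg\,max}_{\lambda\in\bar\Lambda}v^T\nabla^2(\lambda^Tg)(\bar y)v$. ${\rm lin}\,T_C(\bar x)=T_C(\bar x)\cap(-T_C(\bar x))$. $\nabla g_i(\bar y)$ acts on vectors by inner product and is also regarded as a vector in $\mathbb{R}^m$. A partition consists of two disjoint, possibly empty sets with the given union. For $\beta_1,\beta_2\subset\bar I^0$, $\tilde N^{\beta_1,\beta_2}_{GE}$ is the set of all $(\eta_C,q^\ast,q)\in\widehat N_C(\bar x)\times\mathbb{R}^m\times\mathbb{R}^m$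 for which there exist $r\in\mathbb{R}^m$ and reals $\mu_i^r,\mu_i^q$, $i\in\bar{\mathcal I}$, such that \begin{align*} &q^\ast+\nabla^2(\bar\lambda^Tg)(\bar y)q=\sum_{i\in\bar{\mathcal I}}\mu_i^q\nabla g_i(\bar y),\\ &\nabla g_i(\bar y)q=0,\ i\in\bar I^+,\quad \nabla g_i(\bar y)q\leq 0,\ i\in\beta_1,\quad \mu_i^q\geq 0,\ i\in\bar I^0\setminus \beta_1,\\ &\nabla g_i(\bar y)r=0,\ i\in\bar I^+,\quad \nabla g_i(\bar y)q\leq \nabla g_i(\bar y)r,\ i\in\beta_2,\quad \mu_i^q\geq \mu_i^r,\ i\in\bar I^0\setminus \beta_2,\\ &\nabla_y G(\bar x,\bar y)^Tr+\nabla^2(\bar\lambda^Tg)(\bar y)r=\sum_{i\in\bar{\mathcal I}}\mu_i^r\nabla g_i(\bar y),\\ &\eta_C\in \nabla_x G(\bar x,\bar y)^Tr+\widehat N_C(\bar x), \end{align*} and $$M^{\beta_1,\beta_2}_{GE}=\nabla F(\bar x,\bar y)^T\tilde N^{\beta_1,\beta_2}_{GE}=\{(\eta_C -\nabla_xG(\bar x,\bar y)^Tq,\ q^\ast-\nabla_yG(\bar x,\bar y)^Tq)\mid(\eta_C,q^\ast,q)\in\tilde N^{\beta_1,\beta_2}_{GE}\}.$$ *)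

(* Defs.v *)
From HB Require Import structures.
From mathcomp Require Import all_boot all_order all_algebra.
From mathcomp Require Import all_classical all_reals all_analysis.

Set Implicit Arguments.
Unset Strict Implicit.
Unset Printing Implicit Defensive.

Import Order.TTheory GRing.Theory Num.Theory.
Import numFieldNormedType.Exports.

Local Open Scope classical_set_scope.
Local Open Scope ring_scope.

(* Vectors of R^d are row vectors, and R^n x R^m is 'rV[R]_(n + m), with pairs
   written row_mx x y. With the row convention of 'J, the derivative of f at p
   maps u to u *m 'J f p, and its adjoint maps w to w *m ('J f p)^T. *)

Definition dotp (R : realType) (d : nat) (u v : 'rV[R]_d) : R :=
  \sum_i u 0 i * v 0 i.

Definition C1 (R : realType) (d p : nat) (f : 'rV[R]_d -> 'rV[R]_p) : Prop :=
  (forall z, differentiable f z) /\ continuous (fun z => 'J f z).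

Definition grad (R : realType) (d : nat) (f : 'rV[R]_d -> R) (z : 'rV[R]_d) :
    'rV[R]_d :=
  \row_j 'D_(delta_mx 0 j) f z.

Definition hess (R : realType) (d : nat) (f : 'rV[R]_d -> R) (z : 'rV[R]_d) :
    'M[R]_d :=
  'J (grad f) z.

Definition component (R : realType) (d p : nat) (g : 'rV[R]_d -> 'rV[R]_p)
    (i : 'I_p) : 'rV[R]_d -> R :=
  fun z => g z 0 i.

Definition C2 (R : realType) (d p : nat) (g : 'rV[R]_d -> 'rV[R]_p) : Prop :=
  C1 g /\ forall i, C1 (grad (component g i)).

(* Here t_k decreasing to 0 is read as t_k > 0 and t_k --> 0. *)
Definition tangent_cone (R : realType) (d : nat) (Theta : set 'rV[R]_d)
    (z : 'rV[R]_d) : set 'rV[R]_d :=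
  [set u | exists (t : nat -> R) (u_ : nat -> 'rV[R]_d),
    [/\ forall k, 0 < t k, t @ \oo --> (0 : R), u_ @ \oo --> u
      & forall k, Theta (z + t k *: u_ k)]].

Definition polar (R : realType) (d : nat) (K : set 'rV[R]_d) : set 'rV[R]_d :=
  [set zs | forall u, K u -> dotp zs u <= 0].

(* The conjunct Theta z makes the normal cone empty outside Theta. *)
Definition regnormal (R : realType) (d : nat) (Theta : set 'rV[R]_d)
    (z : 'rV[R]_d) : set 'rV[R]_d :=
  [set zs | Theta z /\ polar (tangent_cone Theta z) zs].

Definition polyhedral (R : realType) (d : nat) (S : set 'rV[R]_d) : Prop :=
  exists (p : nat) (a : 'I_p -> 'rV[R]_d) (b : 'I_p -> R),
    S = [set u | forall i, dotp (a i) u <= b i].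

Definition lineality (R : realType) (d : nat) (K : set 'rV[R]_d) : set 'rV[R]_d :=
  [set u | K u /\ K (- u)].

Definition nonpos_orthant (R : realType) (p : nat) : set 'rV[R]_p :=
  [set w | forall i, w 0 i <= 0].

Definition Gamma (R : realType) (m l : nat) (g : 'rV[R]_m -> 'rV[R]_l) :
    set 'rV[R]_m :=
  [set y | forall i, g y 0 i <= 0].

Definition gph_normal (R : realType) (m l : nat) (g : 'rV[R]_m -> 'rV[R]_l) :
    set 'rV[R]_(m + m) :=
  [set w | regnormal (Gamma g) (lsubmx w) (rsubmx w)].

Definition OmegaGE (R : realType) (n m l : nat)
    (G : 'rV[R]_(n + m) -> 'rV[R]_m) (C : set 'rV[R]_n)
    (g : 'rV[R]_m -> 'rV[R]_l) : set 'rV[R]_(n + m) :=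
  [set z | (exists2 ys, regnormal (Gamma g) (rsubmx z) ys & 0 = G z + ys)
           /\ C (lsubmx z)].

Definition mapF (R : realType) (n m : nat) (G : 'rV[R]_(n + m) -> 'rV[R]_m) :
    'rV[R]_(n + m) -> 'rV[R]_(n + (m + m)) :=
  fun z => row_mx (lsubmx z) (row_mx (rsubmx z) (- G z)).

Definition setDGE (R : realType) (n m l : nat) (C : set 'rV[R]_n)
    (g : 'rV[R]_m -> 'rV[R]_l) : set 'rV[R]_(n + (m + m)) :=
  [set w | C (lsubmx w) /\ gph_normal g (rsubmx w)].

Definition GGCQ (R : realType) (n m l : nat)
    (G : 'rV[R]_(n + m) -> 'rV[R]_m) (C : set 'rV[R]_n)
    (g : 'rV[R]_m -> 'rV[R]_l) (z : 'rV[R]_(n + m)) : Prop :=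
  polar (tangent_cone (OmegaGE G C g) z) =
  polar [set w | tangent_cone (setDGE C g) (mapF G z) (w *m 'J (mapF G) z)].

Definition Jx (R : realType) (n m : nat) (G : 'rV[R]_(n + m) -> 'rV[R]_m)
    (x : 'rV[R]_n) (y : 'rV[R]_m) : 'M[R]_(n, m) :=
  'J (fun x' => G (row_mx x' y)) x.

Definition Jy (R : realType) (n m : nat) (G : 'rV[R]_(n + m) -> 'rV[R]_m)
    (x : 'rV[R]_n) (y : 'rV[R]_m) : 'M[R]_m :=
  'J (fun y' => G (row_mx x y')) y.

Definition ggrad (R : realType) (m l : nat) (g : 'rV[R]_m -> 'rV[R]_l)
    (i : 'I_l) (y : 'rV[R]_m) : 'rV[R]_m :=
  grad (component g i) y.

Definition lagr_hess (R : realType) (m l : nat) (g : 'rV[R]_m -> 'rV[R]_l)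
    (lam : 'rV[R]_l) (y : 'rV[R]_m) : 'M[R]_m :=
  hess (fun y' => dotp lam (g y')) y.

(* The argument ys stands for the normal vector at y; Ntilde takes it to be
   - G (row_mx x y). *)
Definition active (R : realType) (m l : nat) (g : 'rV[R]_m -> 'rV[R]_l)
    (y : 'rV[R]_m) : set 'I_l :=
  [set i | g y 0 i = 0].

Definition multipliers (R : realType) (m l : nat) (g : 'rV[R]_m -> 'rV[R]_l)
    (y ys : 'rV[R]_m) : set 'rV[R]_l :=
  [set lam | regnormal (@nonpos_orthant R l) (g y) lam
             /\ lam *m ('J g y)^T = ys].

Definition critical_cone (R : realType) (m l : nat)
    (g : 'rV[R]_m -> 'rV[R]_l) (y ys : 'rV[R]_m) : set 'rV[R]_m :=
  [set v | tangent_cone (Gamma g) y v /\ dotp ys v = 0].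

Definition Iplus (R : realType) (m l : nat) (g : 'rV[R]_m -> 'rV[R]_l)
    (y ys : 'rV[R]_m) : set 'I_l :=
  [set i | exists2 lam, multipliers g y ys lam & 0 < lam 0 i].

Definition Izero (R : realType) (m l : nat) (g : 'rV[R]_m -> 'rV[R]_l)
    (y ys : 'rV[R]_m) : set 'I_l :=
  active g y `\` Iplus g y ys.

Definition dir_multipliers (R : realType) (m l : nat)
    (g : 'rV[R]_m -> 'rV[R]_l) (y ys v : 'rV[R]_m) : set 'rV[R]_l :=
  [set lam | multipliers g y ys lam /\
    forall mu, multipliers g y ys mu ->
      dotp v (v *m lagr_hess g mu y) <= dotp v (v *m lagr_hess g lam y)].

Definition Ntilde (R : realType) (n m l : nat)
    (G : 'rV[R]_(n + m) -> 'rV[R]_m) (C : set 'rV[R]_n)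
    (g : 'rV[R]_m -> 'rV[R]_l) (x : 'rV[R]_n) (y : 'rV[R]_m)
    (lam : 'rV[R]_l) (beta1 beta2 : set 'I_l) : set 'rV[R]_(n + (m + m)) :=
  let ys := - G (row_mx x y) in
  let I := active g y in
  let Ip := Iplus g y ys in
  let I0 := Izero g y ys in
  let H := lagr_hess g lam y in
  [set w | exists etaC qs q,
    [/\ w = row_mx etaC (row_mx qs q), regnormal C x etaC
      & exists (r : 'rV[R]_m) (mur muq : 'I_l -> R),
      [/\ [/\ qs + q *m H = \sum_(i in I) muq i *: ggrad g i y,
              forall i, Ip i -> dotp (ggrad g i y) q = 0,
              forall i, beta1 i -> dotp (ggrad g i y) q <= 0
            & forall i, (I0 `\` beta1) i -> 0 <= muq i],
          [/\ forall i, Ip i -> dotp (ggrad g i y) r = 0,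
              forall i, beta2 i -> dotp (ggrad g i y) q <= dotp (ggrad g i y) r
            & forall i, (I0 `\` beta2) i -> mur i <= muq i],
          r *m (Jy G x y)^T + r *m H = \sum_(i in I) mur i *: ggrad g i y
        & exists2 nu, regnormal C x nu & etaC = r *m (Jx G x y)^T + nu]]].

(* By the form of F, an element (etaC, (qs, q)) of Ntilde is mapped to
   (etaC - q *m (Jx G x y)^T, qs - q *m (Jy G x y)^T). *)
Definition MGE (R : realType) (n m l : nat)
    (G : 'rV[R]_(n + m) -> 'rV[R]_m) (C : set 'rV[R]_n)
    (g : 'rV[R]_m -> 'rV[R]_l) (x : 'rV[R]_n) (y : 'rV[R]_m)
    (lam : 'rV[R]_l) (beta1 beta2 : set 'I_l) : set 'rV[R]_(n + m) :=
  [set w *m ('J (mapF G) (row_mx x y))^T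
     | w in Ntilde G C g x y lam beta1 beta2].

(* Main.v *)
Require Import Defs.
From HB Require Import structures.
From mathcomp Require Import all_boot all_order all_algebra.
From mathcomp Require Import all_classical all_reals all_analysis.
From mathcomp Require Import ring lra.

(** Write L for the linearized cone of all (u, v) whose image under the
    derivative of F is tangent to D. By the constraint qualification the regular
    normal cone of the feasible set is the polar of L, so both formulas follow
    from a cycle of inclusions: the polar of L lies in M, M lies in the adjoint
    image of the regular normal cone to D, and this image lies in the polar of
    L; the last inclusion is immediate by transposition.

    Everything else rests on an explicit tangent cone to the graph of the regular
    normal cone mapping of Gamma ([tangent_gph_normal]). With K the critical cone
    and H the Hessian of the Lagrangian at the fixed multiplier, it consists of
    the (v, vs) such that v lies in K, vs - v H lies in the polar of K, and the
    two are orthogonal. For a tangent sequence, the Mangasarian-Fromovitz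
    condition bounds the multipliers of the approximating normals; along an
    ultrafilter they converge to a multiplier, a second-order expansion of the
    active constraints shows that the limit is a maximizer of the curvature in
    the direction v, and the maximizers being the same in all critical
    directions, its Hessian may be replaced by H ([normal_quotient_limit],
    [normal_quotient_limit_graph]). Conversely, given such a pair (v, vs), one
    minimizes, over the points y + h of Gamma near y, the linear form
    - <ys + t vs, h> plus a large multiple of the squared distance of h to t v.
    The minimizers are of order t and carry a normal of the required form
    ([nearby_normals]); any limit of their quotients by t satisfies a perturbed
    form of the same relation by the first half, and monotonicity forces it to be v
    ([complementary_graph_monotone]).

    This graph contains, for each of beta1 and beta2, the pairs where the
    inequalities of that block are equalities and the multipliers of the other
    block vanish. The corresponding parts of L are polyhedral, and Farkas's lemma
    computes their polars ([face_polar]). An element of the polar of L lies in both, and the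
    difference of the two representations is the vector r, with its multipliers
    mur, required by M. Conversely, pairing the equations of (i) and (ii) with r
    ([shift_pairing]) gives <grad g_j(y), r> = 0 for j in beta2 and mur_k = 0 for
    k in beta1. Hence q lies in K and q* + q H in the polar of K, which makes
    (q*, q) polar to the graph above. *)

Set Implicit Arguments.
Unset Strict Implicit.
Unset Printing Implicit Defensive.

Import Order.TTheory GRing.Theory Num.Theory.
Import numFieldNormedType.Exports.

Local Open Scope classical_set_scope.
Local Open Scope ring_scope.

(** * Inner products and Farkas's lemma *)

Lemma cvg_sumr {R : realType} {V : normedModType R} {T I : Type}
    {F : set_system T} {FF : Filter F} (r : seq I) (P : pred I)
    (f : I -> T -> V) (v : I -> V) :
  (forall i, P i -> f i @ F --> v i) ->
  (fun t => \sum_(i <- r | P i) f i t) @ F --> \sum_(i <- r | P i) v i.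
Proof. by move=> fv; apply: cvg_big => //; exact: add_continuous. Qed.

Section InnerProduct.
Context {R : realType} {d : nat}.
Implicit Types (u v w : 'rV[R]_d) (k : R).

Lemma dotpC u v : dotp u v = dotp v u.
Proof. by apply: eq_bigr => i _; rewrite mulrC. Qed.

Lemma dotpDl u v w : dotp (u + v) w = dotp u w + dotp v w.
Proof. by rewrite -big_split; apply: eq_bigr => i _; rewrite mxE mulrDl. Qed.

Lemma dotpDr u v w : dotp w (u + v) = dotp w u + dotp w v.
Proof. by rewrite dotpC dotpDl !(dotpC w). Qed.

Lemma dotpZl k u v : dotp (k *: u) v = k * dotp u v.
Proof. by rewrite mulr_sumr; apply: eq_bigr => i _; rewrite mxE mulrA. Qed.

Lemma dotpZr k u v : dotp u (k *: v) = k * dotp u v.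
Proof. by rewrite dotpC dotpZl dotpC. Qed.

Lemma dotpNl u v : dotp (- u) v = - dotp u v.
Proof. by rewrite -scaleN1r dotpZl mulN1r. Qed.

Lemma dotpNr u v : dotp u (- v) = - dotp u v.
Proof. by rewrite dotpC dotpNl dotpC. Qed.

Lemma dotpBl u v w : dotp (u - v) w = dotp u w - dotp v w.
Proof. by rewrite dotpDl dotpNl. Qed.

Lemma dotpBr u v w : dotp w (u - v) = dotp w u - dotp w v.
Proof. by rewrite dotpDr dotpNr. Qed.

Lemma dotp0l u : dotp 0 u = 0.
Proof. by rewrite -(scale0r 0) dotpZl mul0r. Qed.

Lemma dotp0r u : dotp u 0 = 0.
Proof. by rewrite dotpC dotp0l. Qed.

Lemma dotp_suml (I : Type) (r : seq I) (P : pred I) (F : I -> 'rV[R]_d) u :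
  dotp (\sum_(i <- r | P i) F i) u = \sum_(i <- r | P i) dotp (F i) u.
Proof.
by apply: (big_morph (fun v => dotp v u)) => [v w|]; rewrite ?dotpDl ?dotp0l.
Qed.

Lemma dotp_delta u j : dotp u (delta_mx 0 j) = u 0 j.
Proof.
rewrite /dotp (bigD1 j)//= big1 ?addr0 => [|i ij].
  by rewrite mxE !eqxx mulr1.
by rewrite mxE (negPf ij) andbF mulr0.
Qed.

Lemma dotp_inj u v : (forall w, dotp u w = dotp v w) -> u = v.
Proof. by move=> uv; apply/rowP => j; rewrite -!dotp_delta uv. Qed.

Lemma dotp_ge0 u : 0 <= dotp u u.
Proof. by apply: sumr_ge0 => i _; rewrite -expr2 sqr_ge0. Qed.

Lemma entry_le_norm u i : `|u 0 i| <= `|u|.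
Proof.
rewrite [leRHS]/Num.Def.normr /= mx_normrE; apply: (le_bigmax _ _ (0, i)).
Qed.

Lemma norm_le_entry u (e : R) : 0 <= e -> (forall i, `|u 0 i| <= e) -> `|u| <= e.
Proof.
move=> e0 ue; rewrite [leLHS]/Num.Def.normr /= mx_normrE.
by apply/bigmax_leP; split=> // -[i j] _ /=; rewrite (ord1 i).
Qed.

Lemma dotp_bound u v : `|dotp u v| <= d%:R * (`|u| * `|v|).
Proof.
apply: (le_trans (ler_norm_sum _ _ _)).
apply: (@le_trans _ _ (\sum_(i < d) (`|u| * `|v|))).
  by apply: ler_sum => i _; rewrite normrM ler_pM// entry_le_norm.
by rewrite sumr_const card_ord mulr_natl.
Qed.

Lemma norm_sqr_le_dotp u : `|u| ^+ 2 <= dotp u u.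
Proof.
have u2 := dotp_ge0 u.
rewrite -(sqr_sqrtr u2) ler_sqr ?nnegrE ?sqrtr_ge0//.
apply: norm_le_entry => [|i]; first exact: sqrtr_ge0.
rewrite -sqrtr_sqr ler_sqrt// expr2 /dotp (bigD1 i)//= lerDl.
by apply: sumr_ge0 => j _; rewrite -expr2 sqr_ge0.
Qed.

Lemma dotp_eq0 u : dotp u u <= 0 -> u = 0.
Proof.
move=> u0; have := le_trans (norm_sqr_le_dotp u) u0.
by rewrite real_exprn_even_le0//= => /eqP/normr0_eq0.
Qed.

Lemma dotp_cvg {T} {F : set_system T} {FF : Filter F} (f h : T -> 'rV[R]_d) u v :
  f @ F --> u -> h @ F --> v -> (fun t => dotp (f t) (h t)) @ F --> dotp u v.
Proof.
move=> fu hv; apply: cvg_sumr => i _; apply: cvgM.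
  exact: (cvg_comp f (fun w : 'rV[R]_d => w 0 i) fu (@coord_continuous _ _ _ 0 i u)).
exact: (cvg_comp h (fun w : 'rV[R]_d => w 0 i) hv (@coord_continuous _ _ _ 0 i v)).
Qed.

End InnerProduct.

Lemma dotp_mulmxl (R : realType) (d p : nat) (u : 'rV[R]_d) (A : 'M[R]_(d, p)) v :
  dotp (u *m A) v = dotp u (v *m A^T).
Proof.
rewrite /dotp.
under eq_bigr do rewrite mxE big_distrl/=.
rewrite exchange_big; apply: eq_bigr => i _; rewrite mxE big_distrr/=.
by apply: eq_bigr => j _; rewrite mxE mulrAC mulrA.
Qed.

Lemma dotp_mulmxr (R : realType) (d p : nat) (u : 'rV[R]_d) (A : 'M[R]_(p, d)) v :
  dotp u (v *m A) = dotp (u *m A^T) v.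
Proof. by rewrite dotpC dotp_mulmxl dotpC. Qed.

Lemma dotp_row_mx (R : realType) (d p : nat) (u u' : 'rV[R]_d) (v v' : 'rV[R]_p) :
  dotp (row_mx u v) (row_mx u' v') = dotp u u' + dotp v v'.
Proof.
rewrite /dotp big_split_ord/=; congr (_ + _).
  by apply: eq_bigr => i _; rewrite !row_mxEl.
by apply: eq_bigr => i _; rewrite !row_mxEr.
Qed.

Section Farkas.
Context {R : realType} {d : nat}.

(** Induction on the constraints. If dropping [a j] destroys the implication, then
    some x0 satisfies the other constraints but violates the conclusion, so
    <a j, x0> > 0. Projecting along x0 onto the kernel of [a j] eliminates this
    constraint, and evaluation at x0 shows that its coefficient is nonnegative. *)
Lemma farkas_seq (T : eqType) (s : seq T) (a : T -> 'rV[R]_d) b :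
  uniq s ->
  (forall x, (forall i, i \in s -> dotp (a i) x <= 0) -> dotp b x <= 0) ->
  exists2 c : T -> R, (forall i, 0 <= c i) & b = \sum_(i <- s) c i *: a i.
Proof.
elim: s a b => [a b _ ab|j s IH a b /= /andP[js us] ab].
  exists (fun=> 0) => //; rewrite big_nil.
  by apply: dotp_eq0; apply: ab.
have [abs|/existsNP[x0 /not_implyP[ax0 /negP]]] := pselect (forall x,
    (forall i, i \in s -> dotp (a i) x <= 0) -> dotp b x <= 0).
  have [c c0 ->] := IH a b us abs.
  exists (fun i => if i == j then 0 else c i) => [i|]; first by case: ifP => // _; exact: c0.
  rewrite big_cons eqxx scale0r add0r; apply: eq_big_seq => i si.
  by case: eqP => // ij; rewrite ij (negPf js) in si.
rewrite -ltNge => bx0.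
have jx0 : 0 < dotp (a j) x0.
  rewrite ltNge; apply/negP => jx0; move: bx0; rewrite ltNge => /negP; apply.
  by apply: ab => i; rewrite inE => /orP[/eqP->//|/ax0].
pose x1 : 'rV[R]_d := (dotp (a j) x0)^-1 *: x0.
have jx1 : dotp (a j) x1 = 1 by rewrite dotpZr mulVf// gt_eqF.
have bx1 : 0 < dotp b x1 by rewrite dotpZr mulr_gt0// invr_gt0.
have ax1 i : i \in s -> dotp (a i) x1 <= 0.
  by move=> si; rewrite dotpZr pmulr_rle0 ?invr_gt0// ax0.
(* The transpose of the projection along x1 onto the kernel of [a j]. *)
pose pr (v : 'rV[R]_d) : 'rV[R]_d := v - dotp v x1 *: a j.
have prE v x : dotp (pr v) x = dotp v (x - dotp (a j) x *: x1).
  by rewrite /pr dotpBl dotpBr dotpZl dotpZr mulrC.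
have [x prx|c c0 bE] := IH (pr \o a) (pr b) us.
  rewrite prE; apply: ab => i; rewrite inE => /orP[/eqP->|si].
    by rewrite dotpBr dotpZr jx1 mulr1 subrr.
  by rewrite -prE; apply: prx.
pose cj := dotp b x1 - \sum_(i <- s) c i * dotp (a i) x1.
exists (fun i => if i == j then cj else c i) => [i|].
  case: ifP => // _; rewrite subr_ge0 (le_trans _ (ltW bx1))//.
  by rewrite big_seq; apply: sumr_le0 => k /ax1 k1; rewrite mulr_ge0_le0.
rewrite big_cons eqxx.
have -> : \sum_(i <- s) (if i == j then cj else c i) *: a i =
    \sum_(i <- s) c i *: a i.
  apply: eq_big_seq => i si.
  by case: eqP => // ij; rewrite ij (negPf js) in si.
have -> : b = pr b + dotp b x1 *: a j by rewrite /pr subrK.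
rewrite bE /=.
have -> : \sum_(i <- s) c i *: pr (a i) = \sum_(i <- s) c i *: a i
    - (\sum_(i <- s) c i * dotp (a i) x1) *: a j.
  rewrite scaler_suml -sumrB; apply: eq_bigr => i _.
  by rewrite scalerBr scalerA.
by rewrite /cj scalerBl [RHS]addrC addrAC addrA.
Qed.

(** For i in E both [a i] and [- a i] are inequality constraints, so that the
    coefficient of an equality is a difference of nonnegative numbers. *)
Lemma farkas (T : finType) (E : set T) (a : T -> 'rV[R]_d) b :
  (forall x, (forall i, E i -> dotp (a i) x = 0) ->
             (forall i, dotp (a i) x <= 0) -> dotp b x <= 0) ->
  exists2 c : T -> R, (forall i, ~ E i -> 0 <= c i) & b = \sum_i c i *: a i.
Proof.
move=> ab.
pose a' (k : T + T) : 'rV[R]_d := match k with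
  | inl i => a i | inr i => if i \in E then - a i else 0 end.
have [x ax|c c0 bE] := @farkas_seq _ (index_enum (T + T)%type) a' b
    (index_enum_uniq _).
  apply: ab => [i /mem_set Ei|i]; last exact: (ax (inl i) (mem_index_enum _)).
  apply/eqP; rewrite eq_le (ax (inl i) (mem_index_enum _))/=.
  by have := ax (inr i) (mem_index_enum _); rewrite /= Ei dotpNl oppr_le0.
exists (fun i => c (inl i) - (if i \in E then c (inr i) else 0)) => [i Ei|].
  by rewrite memNset// subr0.
rewrite bE big_sumType/= -big_split; apply: eq_bigr => i _ /=.
by case: ifP => _; rewrite ?subr0 ?scaler0 ?addr0// scalerBl scalerN.
Qed.

End Farkas.

(** * Second-order calculus *)

Lemma diff_expand {R : realType} {V W : normedModType R} {f : V -> W} {p : V} :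
  differentiable f p -> forall e : R, 0 < e -> exists2 r : R, 0 < r &
    forall h, `|h| < r -> `|f (p + h) - f p - 'd f p h| <= e * `|h|.
Proof.
move=> /diff_locally /eqaddoP df e e0.
have /nbhs_ballP[r r0 rP] := df e e0.
exists r => // h hr; have := rP h; rewrite /ball_ /= -ball_normE /= sub0r normrN.
by move=> /(_ hr); rewrite !fctE /= opprD addrA (addrC h).
Qed.

Section GradientCalculus.
Context {R : realType} {d : nat}.
Implicit Types (f : 'rV[R]_d -> R) (z p h u v w : 'rV[R]_d).

Lemma dotp_grad f z h : differentiable f z -> dotp (grad f z) h = 'd f z h.
Proof.
move=> fz; rewrite {2}(row_sum_delta h) linear_sum; apply: eq_bigr => j _.
by rewrite linearZ mxE deriveE// mulrC.
Qed.

Lemma is_derive_segment f z h s : differentiable f (z + s *: h) ->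
  is_derive s 1 (fun s => f (z + s *: h)) (dotp (grad f (z + s *: h)) h).
Proof.
move=> fz.
have sh : is_diff s (cst z + ( *:%R^~ h)) (0 + ( *:%R^~ h)) :=
  is_diffD (is_diff_cst z s) (is_diff_scalel s h).
have cf := is_diff_comp sh (differentiableP fz).
have [dcf dcfE] := cf.
split; first exact: diff_derivable.
by rewrite deriveE// dcfE /= !fctE add0r scale1r dotp_grad.
Qed.

(** The mean value theorem for the remainder along the segment from p to p + h:
    its derivative is the first-order remainder of the gradient at p, paired with
    h. *)
Lemma taylor2 f p : (forall x, differentiable f x) -> differentiable (grad f) p ->
  forall e : R, 0 < e -> exists2 r : R, 0 < r & forall h, `|h| < r ->
  `|f (p + h) - f p - dotp (grad f p) h - 2^-1 * dotp h (h *m hess f p)| <= e * `|h| ^+ 2.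
Proof.
move=> df dg e e0.
have c0 : 0 < e / (d%:R + 1) by rewrite divr_gt0// ltr_wpDl.
have [r r0 rP] := diff_expand dg c0.
exists r => // h hr.
pose q (s : R) : R := f (p + s *: h) - s * dotp (grad f p) h
  - 2^-1 * s ^+ 2 * dotp h (h *m hess f p).
pose dq (s : R) : R := dotp (grad f (p + s *: h) - grad f p - (s *: h) *m hess f p) h.
have dqE (s : R) : is_derive s 1 q (dq s).
  have fs := is_derive_segment (df (p + s *: h)).
  have ids := is_derive_id s (1 : R).
  have qE := is_deriveB (is_deriveB fs (is_deriveZ (dotp (grad f p) h) ids))
    (is_deriveZ (2^-1 * dotp h (h *m hess f p)) (is_deriveX 2 ids)).
  have -> : q = (fun s : R => f (p + s *: h)) - dotp (grad f p) h *: id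
      - (2^-1 * dotp h (h *m hess f p)) *: (id ^+ 2).
    apply/funext => t; rewrite /q !fctE /= -![_ *: (_ : R)]/(_ * _); ring.
  apply: is_derive_eq qE _.
  rewrite /dq !dotpBl -scalemxAl dotpZl (dotpC (h *m _)).
  rewrite -![_ *: (_ : R)]/(_ * _) expr1; by field.
have cq : {within `[0, 1], continuous q}.
  apply: continuous_subspaceT => t.
  by apply: differentiable_continuous; apply/derivable1_diffP; have [] := dqE t.
have [s s01] := MVT_segment ler01 (fun s _ => dqE s) cq.
rewrite /q scale1r scale0r addr0 !mul0r expr0n/= mulr0 mul0r !subr0 expr1n !mulr1 mul1r.
move=> qE.
have -> : f (p + h) - f p - dotp (grad f p) h - 2^-1 * dotp h (h *m hess f p) = dq s.
  rewrite -qE; ring.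
apply: (le_trans (dotp_bound _ _)).
have s1 : `|s| <= 1 by move: s01; rewrite in_itv/= => /andP[s0 s1]; rewrite ger0_norm.
have shh : `|s *: h| <= `|h| by rewrite normrZ ler_piMl.
have /rP : `|s *: h| < r by rewrite (le_lt_trans shh).
rewrite -deriveE// deriveEjacobian// => {}rP.
apply: (@le_trans _ _ (d%:R * (e / (d%:R + 1) * `|h| * `|h|))).
  by rewrite ler_wpM2l// ler_wpM2r// (le_trans rP)// ler_wpM2l// ltW.
have -> : d%:R * (e / (d%:R + 1) * `|h| * `|h|) =
    (d%:R / (d%:R + 1)) * (e * `|h| ^+ 2) :> R by ring.
rewrite ler_piMl ?mulr_ge0 ?exprn_ge0 ?(ltW e0)//.
by rewrite ler_pdivrMr ?mul1r ?lerDl// ltr_wpDl.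
Qed.

(** The second difference of f over the parallelogram spanned by t u and t w is
    symmetric in u and w, while the mean value theorem in the direction u and the
    differentiability of the gradient show that its quotient by t^2 tends to
    <w (hess f p), u>. *)
Lemma hess_sym f p : (forall x, differentiable f x) -> differentiable (grad f) p ->
  (hess f p)^T = hess f p.
Proof.
move=> df dg.
pose D u w t := f (p + t *: u + t *: w) - f (p + t *: u) - f (p + t *: w) + f p.
have key u w (e : R) : 0 < e -> exists2 r : R, 0 < r & forall t, 0 < t -> t < r ->
    `|D u w t - t ^+ 2 * dotp (w *m hess f p) u| <= e * t ^+ 2.
  move=> e0; pose M := `|u| + `|w| + 1.
  have M0 : 0 < M by rewrite ltr_wpDl// addr_ge0.
  have c0 : 0 < e / (2 * (d%:R + 1) * M ^+ 2).
    by rewrite divr_gt0// mulr_gt0 ?exprn_gt0// mulr_gt0// ltr_wpDl.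
  have [r r0 rP] := diff_expand dg c0.
  exists (r / M); first by rewrite divr_gt0.
  move=> t t0; rewrite ltr_pdivlMr// => tM.
  have cq x : {within `[0, 1], continuous (fun s : R => f (x + s *: (t *: u)))}.
    apply: continuous_subspaceT => s; apply: differentiable_continuous.
    by apply/derivable1_diffP; have [] := is_derive_segment (h := t *: u) (df (x + s *: (t *: u))).
  have dq (s : R) := is_deriveB
    (is_derive_segment (df (p + t *: w + s *: (t *: u))))
    (is_derive_segment (df (p + s *: (t *: u)))).
  have [s s01] := MVT_segment ler01 (fun s _ => dq s)
     (fun s => continuousB (cq (p + t *: w) s) (cq p s)).
  rewrite !fctE scale1r scale0r !addr0 subr0 mulr1 => DE.
  have {DE}-> : D u w t = dotp (grad f (p + (t *: w + s *: (t *: u)))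
      - grad f (p + s *: (t *: u))) (t *: u).
    rewrite addrA dotpBl -DE /D (addrAC p); ring.
  have {s01} [s0 s1] : 0 <= s /\ s <= 1 by move: s01; rewrite in_itv/= => /andP[].
  have stu : `|s *: (t *: u)| <= t * `|u|.
    by rewrite !normrZ (ger0_norm s0) (gtr0_norm t0) ler_piMl// mulr_ge0// ltW.
  have k2 : `|s *: (t *: u)| <= t * M.
    by rewrite (le_trans stu)// ler_pM2l// /M -addrA lerDl addr_ge0.
  have k1 : `|t *: w + s *: (t *: u)| <= t * M.
    rewrite (le_trans (ler_normD _ _))// normrZ (gtr0_norm t0).
    rewrite (le_trans (lerD (lexx _) stu))// -mulrDr ler_pM2l// /M (addrC `|w|).
    by rewrite lerDl.
  have := rP _ (le_lt_trans k2 tM); have := rP _ (le_lt_trans k1 tM).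
  rewrite -!deriveE// !deriveEjacobian// -/(hess f p).
  set g1 := grad f (p + (t *: w + _)); set g2 := grad f (p + s *: _); set c := e / _.
  move=> r1 r2.
  have -> : dotp (g1 - g2) (t *: u) - t ^+ 2 * dotp (w *m hess f p) u =
      dotp ((g1 - grad f p - (t *: w + s *: (t *: u)) *m hess f p)
           - (g2 - grad f p - s *: (t *: u) *m hess f p)) (t *: u).
    rewrite mulmxDl -!scalemxAl !(dotpBl, dotpDl, dotpNl) !(dotpZl, dotpZr).
    by move: (dotp _ _) (dotp _ _) (dotp _ _) (dotp _ _) (dotp _ _) => *; ring.
  apply: (le_trans (dotp_bound _ _)).
  have -> : e * t ^+ 2 = (d%:R + 1) * ((c * (t * M) + c * (t * M)) * (t * M)).
    by rewrite /c; field; rewrite !gt_eqF// ltr_wpDl.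
  have tM0 : 0 <= t * M by rewrite mulr_ge0// ltW.
  apply: ler_pM; rewrite ?mulr_ge0 ?lerDl//.
  apply: ler_pM => //.
    apply: (le_trans (ler_normB _ _)); apply: lerD.
      by rewrite (le_trans r1)// ler_pM2l.
    by rewrite (le_trans r2)// ler_pM2l.
  by rewrite normrZ (gtr0_norm t0) ler_pM2l// /M -addrA lerDl addr_ge0.
have sym u w : dotp (w *m hess f p) u = dotp (u *m hess f p) w.
  apply/eqP; rewrite -subr_eq0 -normr_le0; apply/ler_addgt0Pr => e e0.
  rewrite add0r.
  have [r r0 rP] := key u w (e / 2) (divr_gt0 e0 (ltr0n _ 2)).
  have [s s0 sP] := key w u (e / 2) (divr_gt0 e0 (ltr0n _ 2)).
  pose t := Num.min r s / 2.
  have m0 : 0 < Num.min r s by rewrite lt_min r0.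
  have t0 : 0 < t by rewrite divr_gt0.
  have tm : t < Num.min r s by rewrite ltr_pdivrMr// ltr_pMr// ltr1n.
  move: tm; rewrite lt_min => /andP[/(rP _ t0) H1 /(sP _ t0) H2].
  have t2 : 0 < t ^+ 2 by rewrite exprn_gt0.
  rewrite -(ler_pM2r t2) -[X in _ * X <= _]gtr0_norm// -normrM.
  have -> : (dotp (w *m hess f p) u - dotp (u *m hess f p) w) * t ^+ 2 =
    (D w u t - t ^+ 2 * dotp (u *m hess f p) w)
    - (D u w t - t ^+ 2 * dotp (w *m hess f p) u).
    rewrite /D (addrAC p); ring.
  apply: (le_trans (ler_normB _ _)); apply: (le_trans (lerD H2 H1)).
  by rewrite -mulrDl -splitr.
apply/matrixP => i j; rewrite mxE.
have := sym (delta_mx 0 i) (delta_mx 0 j).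
by rewrite !dotp_delta -!rowE !mxE.
Qed.

End GradientCalculus.

(** * Difference quotients, Lagrangians and Jacobians *)

(** Tangent directions come with moving directions [v_ k], and limits are taken
    later along ultrafilters, whence the general filter. *)
Section DifferenceQuotients.
Context {R : realType} {T : Type} {F : set_system T} {FF : ProperFilter F}.
Context {V : normedModType R} {t : T -> R} {v_ : T -> V} {v : V}.
Context (t0 : forall k, 0 < t k) (tF : t @ F --> 0) (vF : v_ @ F --> v).

Lemma near_scaled_small (r : R) : 0 < r ->
  \forall k \near F, `|t k *: v_ k| < r /\ `|v_ k| <= `|v| + 1.
Proof.
move=> r0; have tv : (fun k => t k *: v_ k) @ F --> (0 : V).
  by rewrite -(scale0r v); apply: cvgZ.
near=> k; split; near: k.
  exact: (cvgr0_norm_lt _ tv).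
by apply: (cvgr_norm_le _ vF); rewrite ltrDl.
Unshelve. all: by end_near. Qed.

Lemma quot_cvg {W : normedModType R} (f : V -> W) (p : V) :
  differentiable f p ->
  (fun k => (t k)^-1 *: (f (p + t k *: v_ k) - f p)) @ F --> ('d f p v : W).
Proof.
move=> fp.
have dv : (fun k => 'd f p (v_ k)) @ F --> 'd f p v.
  apply: (@cvg_comp _ _ _ v_ ('d f p) _ _ _ vF); exact: diff_continuous.
rewrite -(add0r ('d f p v)).
have -> : (fun k => (t k)^-1 *: (f (p + t k *: v_ k) - f p)) =
  (fun k => (t k)^-1 *: (f (p + t k *: v_ k) - f p - 'd f p (t k *: v_ k)))
  + (fun k => 'd f p (v_ k)).
  apply/funext => k; rewrite [in RHS]fctE [X in _ = X + _]scalerBr.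
  have -> : 'd f p (t k *: v_ k) = t k *: 'd f p (v_ k) by rewrite linearZ.
  by rewrite scalerA mulVf ?gt_eqF// scale1r subrK.
apply: cvgD => //; apply/cvgr0Pnorm_le => e e0.
have c0 : 0 < e / (`|v| + 1) by rewrite divr_gt0// ltr_wpDl.
have [r r0 rP] := diff_expand fp c0.
have := near_scaled_small r0; apply: filterS => k [tv vk].
rewrite normrZ normfV gtr0_norm// ler_pdivrMl//.
rewrite (le_trans (rP _ tv))// normrZ gtr0_norm// mulrC -mulrA ler_pM2l//.
by rewrite mulrCA ler_piMr ?(ltW e0)// ler_pdivrMr ?mul1r// ltr_wpDl.
Qed.

End DifferenceQuotients.

Lemma quot2_cvg {R : realType} {d : nat} {T : Type} {F : set_system T}
    {FF : ProperFilter F} {t : T -> R} {v_ : T -> 'rV[R]_d} {v : 'rV[R]_d}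
    (f : 'rV[R]_d -> R) (p : 'rV[R]_d) :
  (forall k, 0 < t k) -> t @ F --> 0 -> v_ @ F --> v ->
  (forall x, differentiable f x) -> differentiable (grad f) p ->
  (fun k => (t k ^+ 2)^-1 *
     (f (p + t k *: v_ k) - f p - t k * dotp (grad f p) (v_ k))) @ F -->
  2^-1 * dotp v (v *m hess f p).
Proof.
move=> t0 tF vF df dg.
have vHv : (fun k => 2^-1 * dotp (v_ k) (v_ k *m hess f p)) @ F -->
    2^-1 * dotp v (v *m hess f p).
  apply: cvgMr; apply: dotp_cvg => //.
  have dE w : w *m hess f p = 'd (grad f) p w by rewrite -deriveE// deriveEjacobian.
  have -> : (fun k => v_ k *m hess f p) = (fun k => 'd (grad f) p (v_ k)).
    by apply/funext => k.
  rewrite dE; apply: (@cvg_comp _ _ _ v_ ('d (grad f) p) _ _ _ vF).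
  exact: diff_continuous.
rewrite -(add0r (2^-1 * _)).
have -> : (fun k => (t k ^+ 2)^-1 *
     (f (p + t k *: v_ k) - f p - t k * dotp (grad f p) (v_ k))) =
  (fun k => (t k ^+ 2)^-1 * (f (p + t k *: v_ k) - f p
     - dotp (grad f p) (t k *: v_ k)
     - 2^-1 * dotp (t k *: v_ k) ((t k *: v_ k) *m hess f p))) +
  (fun k => 2^-1 * dotp (v_ k) (v_ k *m hess f p)).
  apply/funext => k; rewrite !fctE -scalemxAl !(dotpZl, dotpZr).
  by field; rewrite gt_eqF.
apply: cvgD => //; apply/cvgr0Pnorm_le => e e0.
have c0 : 0 < e / (`|v| + 1) ^+ 2 by rewrite divr_gt0// exprn_gt0// ltr_wpDl.
have [r r0 rP] := taylor2 df dg c0.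
have : \forall k \near F, `|t k *: v_ k| < r /\ `|v_ k| <= `|v| + 1.
  exact: near_scaled_small.
apply: filterS => k [tv vk].
have tk2 : 0 < t k ^+ 2 by rewrite exprn_gt0.
rewrite normrM normfV (gtr0_norm tk2) ler_pdivrMl//.
rewrite (le_trans (rP _ tv))// normrZ (gtr0_norm (t0 k)) exprMn mulrCA ler_pM2l//.
rewrite mulrAC ler_pdivrMr ?exprn_gt0 ?ltr_wpDl// ler_pM2l//.
by rewrite ler_sqr ?nnegrE// addr_ge0.
Unshelve. all: by end_near. Qed.

Lemma diff_jacobian {R : realType} {d p : nat} (f : 'rV[R]_d -> 'rV[R]_p) z u :
  differentiable f z -> u *m 'J f z = 'd f z u.
Proof. by move=> fz; rewrite -deriveEjacobian// deriveE. Qed.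

Lemma is_diff_mulmxr {R : realType} {d p : nat} (A : 'M[R]_(d, p)) (u : 'rV[R]_d) :
  is_diff u (mulmxr A : 'rV[R]_d -> 'rV[R]_p) (mulmxr A).
Proof.
have cA : continuous (mulmxr A : 'rV[R]_d -> 'rV[R]_p).
  move=> v; rewrite /continuous_at /mulmxr mulmx_sum_row.
  have -> : (fun w : 'rV[R]_d => w *m A) = (fun w => \sum_i w 0 i *: row i A).
    by apply/funext => w; rewrite mulmx_sum_row.
  apply: (@cvg_sumr _ _ _ _ _ (nbhs_filter v)) => i _.
  by apply: cvgZr_tmp; exact: coord_continuous.
apply: DiffDef; first exact: linear_differentiable.
exact: diff_lin.
Qed.

Section Components.
Context {R : realType} {m l : nat}.
Implicit Types (g : 'rV[R]_m -> 'rV[R]_l) (y v w : 'rV[R]_m) (lam : 'rV[R]_l).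

Lemma component_differentiable g y i :
  differentiable g y -> differentiable (component g i) y.
Proof.
by move=> gy; exact: (differentiable_comp gy (differentiable_coord (g y) 0 i)).
Qed.

Lemma dotp_ggrad g y i h : differentiable g y ->
  dotp (ggrad g i y) h = 'd g y h 0 i.
Proof.
move=> gy; rewrite dotp_grad; last exact: component_differentiable.
rewrite -deriveE; last exact: component_differentiable.
by rewrite -deriveE// derive_mx ?mxE//; exact: diff_derivable.
Qed.

Lemma mulmx_jacobianT g y lam : differentiable g y ->
  lam *m ('J g y)^T = \sum_i lam 0 i *: ggrad g i y.
Proof.
move=> gy; apply: dotp_inj => w; rewrite -dotp_mulmxr diff_jacobian// dotp_suml.
by apply: eq_bigr => i _; rewrite dotpZl dotp_ggrad.
Qed.

Lemma lagrangian_differentiable g lam y : differentiable g y ->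
  differentiable (fun y' => dotp lam (g y')) y /\
  grad (fun y' => dotp lam (g y')) y = \sum_i lam 0 i *: ggrad g i y.
Proof.
move=> gy.
have LE : (fun y' => dotp lam (g y')) = \sum_i (lam 0 i *: component g i).
  by apply/funext => y'; rewrite fct_sumE.
have dL : differentiable (fun y' => dotp lam (g y')) y.
  rewrite LE; apply: differentiable_sum => i.
  by apply: differentiableZ; exact: component_differentiable.
split => //; apply: dotp_inj => w; rewrite dotp_grad// -deriveE// LE derive_sum.
  rewrite dotp_suml; apply: eq_bigr => i _.
  have ci := component_differentiable i gy.
  by rewrite deriveZ ?deriveE// ?dotpZl ?dotp_grad//; exact: diff_derivable.
move=> i; apply: derivableZ; apply: diff_derivable.
exact: component_differentiable.
Qed.

Lemma mul_lagr_hess g lam y v : C2 g ->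
  v *m lagr_hess g lam y = \sum_i lam 0 i *: (v *m hess (component g i) y).
Proof.
move=> [[dg _] g2]; rewrite /lagr_hess /hess.
pose f i := lam 0 i *: grad (component g i).
have -> : grad (fun y' => dotp lam (g y')) = \sum_i f i.
  apply/funext => z; rewrite (lagrangian_differentiable _ (dg z)).2.
  by rewrite fct_sumE.
have df i : differentiable (f i) y.
  by apply: differentiableZ; exact: (g2 i).1.
have dsum : differentiable (\sum_i f i) y := differentiable_sum df.
transitivity ('d (\sum_i f i) y v); first exact: (diff_jacobian v dsum).
transitivity ('D_v (\sum_i f i) y); first exact/esym/(deriveE v dsum).
rewrite derive_sum; last by move=> i; exact: diff_derivable.
apply: eq_bigr => i _; rewrite /f deriveZ; last exact/diff_derivable/(g2 i).1.
by rewrite diff_jacobian ?deriveE//; exact: (g2 i).1.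
Qed.

Lemma lagr_hess_sym g lam y : C2 g -> (lagr_hess g lam y)^T = lagr_hess g lam y.
Proof.
move=> g2; have H (u w : 'rV_m) : dotp (u *m lagr_hess g lam y) w =
    dotp (w *m lagr_hess g lam y) u.
  rewrite (mul_lagr_hess lam y u g2) (mul_lagr_hess lam y w g2) !dotp_suml; apply: eq_bigr => i _.
  rewrite !dotpZl dotp_mulmxl hess_sym; first by rewrite dotpC.
    by move=> z; apply: component_differentiable; exact: g2.1.1.
  exact: (g2.2 i).1.
apply/matrixP => i j; rewrite mxE.
have := H (delta_mx 0 i) (delta_mx 0 j).
by rewrite !dotp_delta -!rowE !mxE.
Qed.

End Components.

Section JacobianOfF.
Context {R : realType} {n m : nat} (G : 'rV[R]_(n + m) -> 'rV[R]_m).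

Lemma mul_Jx (x u : 'rV[R]_n) (y : 'rV[R]_m) : differentiable G (row_mx x y) ->
  u *m Jx G x y = 'd G (row_mx x y) (row_mx u 0).
Proof.
move=> dG; pose A : 'M[R]_(n, n + m) := row_mx 1%:M 0.
have AE w : row_mx w y = w *m A + row_mx 0 y.
  by rewrite mul_mx_row mulmx1 mulmx0 add_row_mx addr0 add0r.
have [di diE] := is_diffD (is_diff_mulmxr A x) (is_diff_cst (row_mx 0 y : 'rV_(n + m)) x).
have iE : (mulmxr A : 'rV_n -> _) + cst (row_mx 0 y) = (fun w => row_mx w y).
  by apply/funext => w; rewrite fctE [RHS]AE.
rewrite iE in di diE.
have [dc dcE] := is_diff_comp (DiffDef _ di diE) (differentiableP dG).
rewrite diff_jacobian// dcE /= !fctE addr0 /mulmxr mul_mx_row mulmx1 mulmx0//.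
Qed.

Lemma mul_Jy (x : 'rV[R]_n) (y v : 'rV[R]_m) : differentiable G (row_mx x y) ->
  v *m Jy G x y = 'd G (row_mx x y) (row_mx 0 v).
Proof.
move=> dG; pose A : 'M[R]_(m, n + m) := row_mx 0 1%:M.
have AE w : row_mx x w = w *m A + row_mx x 0.
  by rewrite mul_mx_row mulmx1 mulmx0 add_row_mx addr0 add0r.
have [di diE] := is_diffD (is_diff_mulmxr A y) (is_diff_cst (row_mx x 0 : 'rV_(n + m)) y).
have iE : (mulmxr A : 'rV_m -> _) + cst (row_mx x 0) = (fun w => row_mx x w).
  by apply/funext => w; rewrite fctE [RHS]AE.
rewrite iE in di diE.
have [dc dcE] := is_diff_comp (DiffDef _ di diE) (differentiableP dG).
rewrite diff_jacobian// dcE /= !fctE addr0 /mulmxr mul_mx_row mulmx1 mulmx0//.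
Qed.

Lemma mul_JmapF (x u : 'rV[R]_n) (y v : 'rV[R]_m) :
  differentiable G (row_mx x y) ->
  row_mx u v *m 'J (mapF G) (row_mx x y) =
  row_mx u (row_mx v (- (u *m Jx G x y + v *m Jy G x y))).
Proof.
move=> dG.
pose A : 'M[R]_(n + m, n + (m + m)) :=
  row_mx (col_mx 1%:M 0) (row_mx (col_mx 0 1%:M) 0).
pose B : 'M[R]_(m, n + (m + m)) := row_mx 0 (row_mx 0 (- 1%:M)).
have AE w : w *m A = row_mx (lsubmx w) (row_mx (rsubmx w) 0).
  rewrite -{1}(hsubmxK w) !mul_mx_row !mul_row_col !mulmx1 !mulmx0.
  by rewrite addr0 add0r.
have BE w : w *m B = row_mx 0 (row_mx 0 (- w)).
  by rewrite !mul_mx_row !mulmx0 mulmxN mulmx1.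
have [dF dFE] := is_diffD (is_diff_mulmxr A (row_mx x y))
  (is_diff_comp (differentiableP dG) (is_diff_mulmxr B (G (row_mx x y)))).
have FE : (mulmxr A : 'rV_(n + m) -> _) + (mulmxr B \o G) = mapF G.
  apply/funext => w; rewrite /mapF !fctE /= AE BE.
  by rewrite !add_row_mx !addr0 add0r.
rewrite FE in dF dFE.
rewrite diff_jacobian// dFE fctE /= AE BE !add_row_mx !addr0 add0r.
rewrite row_mxKl row_mxKr mul_Jx// mul_Jy// -linearD add_row_mx addr0 add0r.
by [].
Qed.

End JacobianOfF.

(** * Tangent cones and convergence along ultrafilters *)

Lemma compact_norm_ball {R : realType} {d : nat} (c : R) :
  compact [set u : 'rV[R]_d | `|u| <= c].
Proof.
apply: bounded_closed_compact.
  by exists c; split; [exact: num_real|move=> M cM u /= uc; rewrite (le_trans uc)// ltW].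
apply: (@closed_comp _ _ (fun u : 'rV[R]_d => `|u|) [set r | r <= c]).
  by move=> u _; exact: norm_continuous.
exact: closed_le.
Qed.

(** Along one ultrafilter all bounded families converge simultaneously, which
    replaces successive extractions of subsequences. *)
Lemma ultra_bounded_cvg {R : realType} {d : nat} {T : Type} {U : set_system T}
    {UU : UltraFilter U} (f : T -> 'rV[R]_d) (c : R) :
  (\forall k \near U, `|f k| <= c) -> exists p : 'rV[R]_d, f @ U --> p.
Proof.
move=> fc.
have [p [_ pU]] := @compact_norm_ball R d c (f @ U) _ fc.
exists p => B Bp.
have [//|UB] := in_ultra_setVsetC (f @^-1` B) UU.
have [q [Bq q']] := pU (~` B) B UB Bp.
by [].
Qed.

Section TangentCone.
Context {R : realType} {d : nat}.
Implicit Types (Theta : set 'rV[R]_d) (z u : 'rV[R]_d).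

(** This form has no sequence in it, so it accepts limits along any filter. *)
Lemma tangent_coneP Theta z u : tangent_cone Theta z u <->
  forall e : R, 0 < e -> exists (t : R) (u' : 'rV[R]_d),
    [/\ 0 < t, t < e, `|u - u'| < e & Theta (z + t *: u')].
Proof.
split=> [[t [u_ [t0 tF uF Tz]]] e e0|H].
  have : \forall k \near \oo, `|t k| < e /\ `|u - u_ k| < e.
    near=> k; split; near: k; first exact: (cvgr0_norm_lt _ tF).
    by move/cvgrPdist_lt : uF; apply.
  move=> [k _ /(_ k (leqnn k))[tk uk]].
  by exists (t k), (u_ k); split=> //; rewrite -(gtr0_norm (t0 k)).
have /choice[t /choice[u_ tu]] : forall k, exists t u', [/\ 0 < t, t < (@harmonic R k),
    `|u - u'| < harmonic k & Theta (z + t *: u')].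
  by move=> k; apply: H; rewrite /harmonic invr_gt0.
exists t, u_; split=> [k|||k].
- by have [] := tu k.
- apply: (@squeeze_cvgr _ _ _ _ (fun=> 0) harmonic) => //.
  + by near=> k; have [/ltW-> /ltW->] := tu k.
  + exact: cvg_cst.
  + exact: cvg_harmonic.
- apply/cvgrPdist_lt => e e0.
  have : \forall k \near \oo, `|@harmonic R k| < e.
    exact: (cvgr0_norm_lt _ cvg_harmonic).
  apply: filterS => k; have [_ _ uk _] := tu k; apply: lt_trans.
  by rewrite (lt_le_trans uk)// ler_norm.
- by have [] := tu k.
Unshelve. all: by end_near. Qed.

Lemma tangent_cone_filter {T : Type} {F : set_system T} {FF : ProperFilter F}
    (t : T -> R) (u_ : T -> 'rV[R]_d) Theta z u :
  (forall k, 0 < t k) -> t @ F --> 0 -> u_ @ F --> u ->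
  (\forall k \near F, Theta (z + t k *: u_ k)) -> tangent_cone Theta z u.
Proof.
move=> t0 tF uF Tz; apply/tangent_coneP => e e0.
suff /filter_ex[k [tk uk Tk]] : \forall k \near F,
    [/\ `|t k| < e, `|u - u_ k| < e & Theta (z + t k *: u_ k)].
  by exists (t k), (u_ k); split=> //; rewrite -(gtr0_norm (t0 k)).
near=> k; split; near: k => //; first exact: (cvgr0_norm_lt _ tF).
by move/cvgrPdist_lt : uF; apply.
Unshelve. all: by end_near. Qed.

Lemma tangent_cone0 Theta z : Theta z -> tangent_cone Theta z 0.
Proof.
move=> Tz; apply/tangent_coneP => e e0; exists (e / 2), 0; split.
- by rewrite divr_gt0.
- by rewrite ltr_pdivrMr// ltr_pMr// ltr1n.
- by rewrite subrr normr0.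
- by rewrite scaler0 addr0.
Qed.

Lemma tangent_coneZ Theta z u (s : R) : 0 < s ->
  tangent_cone Theta z u -> tangent_cone Theta z (s *: u).
Proof.
move=> s0 /tangent_coneP Tu; apply/tangent_coneP => e e0.
have [|t [u' [t0 te ue Tu']]] := Tu (Num.min (e / s) (e * s)).
  by rewrite lt_min divr_gt0 ?mulr_gt0.
move: te ue; rewrite !lt_min => /andP[_ te] /andP[ue _].
exists (t / s), (s *: u'); split.
- by rewrite divr_gt0.
- by rewrite ltr_pdivrMr.
- by rewrite -scalerBr normrZ (gtr0_norm s0) mulrC -ltr_pdivlMr.
- by rewrite scalerA divfK// gt_eqF.
Qed.

Lemma tangent_cone_approx Theta z u :
  (forall e : R, 0 < e -> exists2 w, `|u - w| < e & tangent_cone Theta z w) ->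
  tangent_cone Theta z u.
Proof.
move=> H; apply/tangent_coneP => e e0.
have e2 : 0 < e / 2 by rewrite divr_gt0.
have [w uw /tangent_coneP/(_ _ e2)[t [u' [t0 te wu Tz]]]] := H _ e2.
exists t, u'; split => //.
  by rewrite (lt_le_trans te)// ler_pdivrMr// ler_peMr ?ler1n// ltW.
by rewrite -(subrK w u) -addrA (le_lt_trans (ler_normD _ _))// (splitr e) ltrD.
Qed.

End TangentCone.

(** The direction [- delta_mx 0 i] is always tangent to the orthant at w, and
    [delta_mx 0 i] is tangent when w_i < 0. *)
Lemma regnormal_orthant {R : realType} {l : nat} (w lam : 'rV[R]_l) :
  regnormal (@nonpos_orthant R l) w lam <->
  [/\ forall i, w 0 i <= 0, forall i, 0 <= lam 0 i &
      forall i, lam 0 i != 0 -> w 0 i = 0].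
Proof.
split=> [[w0 pol]|[w0 lam0 comp]].
  have lam0 i : 0 <= lam 0 i.
    rewrite -oppr_le0 -dotp_delta -dotpNr; apply: pol.
    apply/tangent_coneP => e e0; exists (e / 2), (- delta_mx 0 i); split.
    - by rewrite divr_gt0.
    - by rewrite ltr_pdivrMr// ltr_pMr// ltr1n.
    - by rewrite subrr normr0.
    - move=> j; rewrite !mxE; have := w0 j; case: (_ && _) => /=; lra.
  split=> // i; apply: contraTeq => wi; rewrite negbK eq_le lam0 andbT.
  have {}wi : w 0 i < 0 by rewrite lt_neqAle wi w0.
  rewrite -dotp_delta; apply: pol; apply/tangent_coneP => e e0.
  exists (Num.min (e / 2) (- w 0 i)), (delta_mx 0 i); split.
  - by rewrite lt_min divr_gt0// oppr_gt0.
  - by rewrite gt_min ltr_pdivrMr// ltr_pMr ?ltr1n.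
  - by rewrite subrr normr0.
  - move=> j; rewrite !mxE eqxx /=; case: eqP => [->|_]; last first.
      by rewrite mulr0 addr0 w0.
    by rewrite mulr1 -lerBrDl sub0r ge_min lexx orbT.
split=> // u [t [u_ [t0 tF uF Tz]]].
apply: sumr_le0 => i _; have [->|li] := eqVneq (lam 0 i) 0; first by rewrite mul0r.
rewrite mulr_ge0_le0//.
have uiF : (fun k => u_ k 0 i) @ \oo --> u 0 i.
  exact: (cvg_comp u_ (fun w : 'rV[R]_l => w 0 i) uF (@coord_continuous _ _ _ 0 i u)).
apply: (cvgr_to_le uiF); near=> k.
have := Tz k i; rewrite !mxE comp// add0r.
by rewrite pmulr_rle0.
Unshelve. all: by end_near. Qed.

(** * Multipliers under the Mangasarian-Fromovitz condition *)

Section Constraints.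
Context {R : realType} {m l : nat} (g : 'rV[R]_m -> 'rV[R]_l).
Implicit Types (y v w ys : 'rV[R]_m) (lam : 'rV[R]_l).

(** The Mangasarian-Fromovitz condition at y, with vh as its witness. *)
Definition mfcq y vh := forall i, active g y i -> dotp (ggrad g i y) vh < 0.

Lemma multipliersP y ys lam : differentiable g y -> multipliers g y ys lam <->
  [/\ Gamma g y, forall i, 0 <= lam 0 i, forall i, lam 0 i != 0 -> active g y i
    & \sum_i lam 0 i *: ggrad g i y = ys].
Proof.
move=> gy; rewrite -mulmx_jacobianT//.
split=> [[/regnormal_orthant[g0 l0 lg] E]|[g0 l0 lg E]]; first by split.
by split=> //; apply/regnormal_orthant; split.
Qed.

Lemma tangent_Gamma_le y v i : differentiable g y -> active g y i ->
  tangent_cone (Gamma g) y v -> dotp (ggrad g i y) v <= 0.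
Proof.
move=> gy gi [t [v_ [t0 tF vF Gy]]].
have ci := component_differentiable i gy.
rewrite dotp_grad//.
apply: (cvgr_to_le (quot_cvg t0 tF vF ci)); near=> k.
rewrite -[_ *: _]/(_ * _) pmulr_rle0 ?invr_gt0//.
by rewrite /component gi subr0; exact: Gy.
Unshelve. all: by end_near. Qed.

Lemma strict_tangent_Gamma y w : Gamma g y -> differentiable g y ->
  mfcq y w -> tangent_cone (Gamma g) y w.
Proof.
move=> Gy gy yw.
have t0 k : 0 < @harmonic R k by rewrite /harmonic invr_gt0.
have wF : (fun=> w) @ \oo --> w by exact: cvg_cst.
apply: (tangent_cone_filter t0 cvg_harmonic wF).
apply: filter_forall => i.
have ci := component_differentiable i gy.
have [gi|/eqP gi] := eqVneq (g y 0 i) 0.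
  have q : (fun k => (@harmonic R k)^-1 *
      (component g i (y + @harmonic R k *: w) - component g i y)) @ \oo -->
      dotp (ggrad g i y) w.
    by rewrite dotp_grad//; exact: (quot_cvg t0 cvg_harmonic wF ci).
  have q0 : \forall k \near \oo, (@harmonic R k)^-1 *
      (component g i (y + @harmonic R k *: w) - component g i y) < 0.
    exact: (cvgr_lt _ q _ (yw i gi)).
  apply: filterS q0 => k.
  rewrite pmulr_rlt0 ?invr_gt0// /component gi subr0.
  exact: ltW.
have {}gi : component g i y < 0 by rewrite lt_neqAle (Gy i) andbT; apply/eqP.
have yF : (fun k => y + @harmonic R k *: w) @ \oo --> y.
  rewrite -{2}(addr0 y) -(scale0r w); apply: cvgD; first exact: cvg_cst.
  by apply: cvgZ => //; exact: cvg_harmonic.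
have q : (fun k => component g i (y + @harmonic R k *: w)) @ \oo --> component g i y.
  apply: (@cvg_comp _ _ _ _ (component g i) _ _ _ yF).
  exact: differentiable_continuous.
have q0 : \forall k \near \oo, component g i (y + @harmonic R k *: w) < 0.
  exact: (cvgr_lt _ q _ gi).
by apply: filterS q0 => k /ltW.
Qed.

(** If v satisfies the linearized constraints then v + e vh satisfies them
    strictly for every e > 0, hence is tangent by first-order expansion; let e
    tend to 0. *)
Lemma tangent_GammaP y vh v : Gamma g y -> differentiable g y -> mfcq y vh ->
  tangent_cone (Gamma g) y v <->
  forall i, active g y i -> dotp (ggrad g i y) v <= 0.
Proof.
move=> Gy gy mf; split=> [Tv i gi|lin]; first exact: tangent_Gamma_le.
apply: tangent_cone_approx => e e0.
have c0 : 0 < e / (`|vh| + 1) by rewrite divr_gt0// ltr_wpDl.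
exists (v + e / (`|vh| + 1) *: vh).
  rewrite opprD addNKr normrN normrZ gtr0_norm// mulrAC.
  by rewrite ltr_pdivrMr ?ltr_wpDl// ltr_pM2l// ltrDl.
apply: strict_tangent_Gamma => // i gi.
rewrite dotpDr dotpZr -(addr0 0) ler_ltD ?lin//.
by rewrite pmulr_rlt0// mf.
Qed.

(** The tangent cone is cut out by the active gradients, so Farkas's lemma gives
    the multipliers. *)
Lemma regnormal_Gamma_multipliers y vh ys : differentiable g y -> mfcq y vh ->
  regnormal (Gamma g) y ys -> exists lam, multipliers g y ys lam.
Proof.
move=> gy mf [Gy pol].
pose a i := if `[<active g y i>] then ggrad g i y else 0.
have [x _ ax|c c0 ysE] := @farkas R m 'I_l set0 a ys.
  apply: pol; apply/(tangent_GammaP _ Gy gy mf) => i gi.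
  by have := ax i; rewrite /a; case: asboolP.
exists (\row_i (if `[<active g y i>] then c i else 0)).
apply/multipliersP => //; split=> // [i|i|].
- by rewrite mxE; case: ifP => // _; exact: c0.
- by rewrite mxE; case: asboolP => //; rewrite eqxx.
- rewrite ysE; apply: eq_bigr => i _; rewrite mxE /a.
  by case: asboolP; rewrite ?scaler0 ?scale0r.
Qed.

(** Near y, the constraints active at y' are active at y and, by continuity of the
    gradients, - <grad g_i(y'), vh> stays above a positive eta_i. Pairing a normal
    ys with vh then gives lam_i eta_i <= - <ys, vh>. *)
Lemma multipliers_bounded y vh : C2 g -> mfcq y vh ->
  exists2 c : R, 0 <= c & \forall y' \near y, forall ys,
    regnormal (Gamma g) y' ys ->
    exists2 lam, multipliers g y' ys lam & `|lam| <= c * `|ys|.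
Proof.
move=> [[dg _] g2] mf.
have gradC i : {for y, continuous (ggrad g i)}.
  by apply: differentiable_continuous; exact: (g2 i).1.
have gC i : {for y, continuous (component g i)}.
  by apply: differentiable_continuous; exact: component_differentiable.
pose eta i := - dotp (ggrad g i y) vh / 2.
have near_i i : \forall y' \near y, active g y' i ->
    active g y i /\ eta i < - dotp (ggrad g i y') vh.
  have [gi|/eqP gi] := eqVneq (g y 0 i) 0; last first.
    have : \forall y' \near y, component g i y' != 0.
      by apply: (cvgr_neq0 _ (gC i)); apply/eqP.
    by apply: filterS => y' /eqP gy' gi'.
  have e0 : 0 < - dotp (ggrad g i y) vh by rewrite oppr_gt0 mf.
  have q : (fun y' => - dotp (ggrad g i y') vh) @ y --> - dotp (ggrad g i y) vh.
    have q1 : (fun y2 => dotp (ggrad g i y2) vh) @ y --> dotp (ggrad g i y) vh.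
      by refine (@dotp_cvg R m _ (nbhs y) _ (ggrad g i) (fun=> vh) _ _ (gradC i) _); exact: cvg_cst.
    exact: cvgN q1.
  have ei : eta i < - dotp (ggrad g i y) vh.
    by rewrite /eta ltr_pdivrMr// ltr_pMr// ltr1n.
  have q0 : \forall y' \near y, eta i < - dotp (ggrad g i y') vh.
    exact: (cvgr_gt _ q _ ei).
  by apply: filterS q0 => y' gt _; split.
pose c := \sum_i `|eta i|^-1 * (m%:R * `|vh|).
have c0 : 0 <= c by apply: sumr_ge0 => i _; rewrite !mulr_ge0 ?invr_ge0.
exists c => //.
have : \forall y' \near y, forall i, active g y' i ->
    active g y i /\ eta i < - dotp (ggrad g i y') vh.
  exact: (filter_forall (nbhs_filter y) near_i).
apply: filterS => y' act ys nys.
have eta0 i : active g y i -> 0 < eta i.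
  by move=> gi; rewrite /eta divr_gt0// oppr_gt0 mf.
have mf' : mfcq y' vh.
  move=> i gi; have [/eta0 h1 h2] := act i gi.
  by rewrite -oppr_gt0 (lt_trans h1).
have [lam lamM] := regnormal_Gamma_multipliers (dg y') mf' nys.
exists lam => //.
have [Gy' l0 la lE] := (multipliersP _ _ (dg y')).1 lamM.
apply: norm_le_entry; first by rewrite mulr_ge0.
move=> i; rewrite (ger0_norm (l0 i)).
have [->|li] := eqVneq (lam 0 i) 0; first by rewrite mulr_ge0.
have [gi etai] := act i (la i li).
have ei := eta0 i gi.
have le1 : lam 0 i * eta i <= - dotp ys vh.
  rewrite -lE dotp_suml (bigD1 i)//= opprD dotpZl.
  rewrite -[leLHS]addr0 lerD//.
    by rewrite -mulrN ler_wpM2l// ltW.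
  rewrite oppr_ge0; apply: sumr_le0 => j _; rewrite dotpZl.
  have [->|lj] := eqVneq (lam 0 j) 0; first by rewrite mul0r.
  by rewrite mulr_ge0_le0// ltW// mf'//; exact: la.
have le2 : - dotp ys vh <= m%:R * `|vh| * `|ys|.
  rewrite (le_trans (ler_norm _))// normrN (le_trans (dotp_bound _ _))//.
  by rewrite -mulrA (mulrC `|ys|).
have : lam 0 i <= `|eta i|^-1 * (m%:R * `|vh|) * `|ys|.
  by rewrite (gtr0_norm ei) -mulrA ler_pdivlMl// mulrC (le_trans le1).
move=> /le_trans; apply; rewrite ler_wpM2r// /c (bigD1 i)//= lerDl.
by apply: sumr_ge0 => j _; rewrite !mulr_ge0 ?invr_ge0.
Qed.

(** For a multiplier mu of ys, <ys, v> is the sum of the nonpositive terms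
    mu_i <grad g_i(y), v>, so it vanishes exactly when each of them does. *)
Lemma critical_coneP y vh ys lam v : differentiable g y -> mfcq y vh ->
  multipliers g y ys lam ->
  critical_cone g y ys v <->
  (forall i, active g y i -> dotp (ggrad g i y) v <= 0) /\
  (forall i, Iplus g y ys i -> dotp (ggrad g i y) v = 0).
Proof.
move=> gy mf lamM.
have Gy : Gamma g y by have [] := (multipliersP _ _ gy).1 lamM.
split=> [[/(tangent_GammaP _ Gy gy mf) lin ysv]|[lin eq0]].
  split=> // i [mu muM mui].
  have [_ m0 ma mE] := (multipliersP _ _ gy).1 muM.
  move: ysv; rewrite -mE dotp_suml => /eqP.
  have le0 j : dotp (mu 0 j *: ggrad g j y) v <= 0.
    rewrite dotpZl; have [->|mj] := eqVneq (mu 0 j) 0; first by rewrite mul0r.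
    by rewrite mulr_ge0_le0// lin//; exact: ma.
  rewrite -oppr_eq0 -sumrN psumr_eq0 => [/allP/(_ i (mem_index_enum _))|j _].
    rewrite oppr_eq0 dotpZl mulf_eq0 (gt_eqF mui)/= => /eqP//.
  by rewrite oppr_ge0.
split; first by apply/(tangent_GammaP _ Gy gy mf).
have [_ m0 ma <-] := (multipliersP _ _ gy).1 lamM.
rewrite dotp_suml big1// => i _; rewrite dotpZl.
have [->|li] := eqVneq (lam 0 i) 0; first by rewrite mul0r.
by rewrite eq0 ?mulr0//; exists lam => //; rewrite lt_neqAle eq_sym li m0.
Qed.

End Constraints.

(** * Limits of difference quotients of the normal cone mapping *)

Lemma cvg_scaled_perturbation {R : realType} {V : normedModType R} {T : Type}
    {F : set_system T} {FF : Filter F} (t : T -> R) (u_ : T -> V) (u z : V) :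
  t @ F --> 0 -> u_ @ F --> u -> (fun k => z + t k *: u_ k) @ F --> z.
Proof.
move=> tF uF; rewrite -{2}(addr0 z) -(scale0r u).
by apply: cvgD; [exact: cvg_cst|exact: cvgZ].
Qed.

Section NormalConeGraph.
Context {R : realType} {m l : nat} (g : 'rV[R]_m -> 'rV[R]_l).
Context (y ys vh : 'rV[R]_m) (g2 : C2 g) (mf : mfcq g y vh).

Let dg z : differentiable g z. Proof. exact: g2.1.1. Qed.
Let dc i z : differentiable (component g i) z.
Proof. exact: component_differentiable. Qed.
Let dgr i z : differentiable (ggrad g i) z.
Proof. exact: (g2.2 i).1. Qed.

(** Let lt be the limit of multipliers lam_ of the normals ys + t vs_ at y + t v_.
    The vectors W, combinations of the gradients at y with the coefficients
    (lam_ - lt) / t, tend to vs - v (hess of the Lagrangian at lt), since the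
    rest of the quotient vs_ is made of quotients of the gradients. On critical
    directions W is nonpositive: the gradients with lt_i > 0 vanish there, and
    where lt_i = 0 the coefficient is nonnegative. The last estimate comes from the
    inequality sum_i (mu_i - lam_i) (g_i(y + t v_) - g_i(y)) <= 0, divided by t^2
    and expanded to second order. For mu = lt it says that the limit of W is
    nonnegative at v. *)
Lemma normal_quotient_limit {T : Type} {U : set_system T} {UU : UltraFilter U}
    (t : T -> R) (v_ vs_ : T -> 'rV[R]_m) (v vs : 'rV[R]_m) :
  (forall k, 0 < t k) -> t @ U --> 0 -> v_ @ U --> v -> vs_ @ U --> vs ->
  (forall k, regnormal (Gamma g) (y + t k *: v_ k) (ys + t k *: vs_ k)) ->
  exists lt, [/\ multipliers g y ys lt, critical_cone g y ys v,
    forall q, critical_cone g y ys q -> dotp (vs - v *m lagr_hess g lt y) q <= 0 &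
    forall mu, multipliers g y ys mu ->
      dotp v (v *m lagr_hess g mu y) - dotp v (v *m lagr_hess g lt y) <=
      2 * dotp (vs - v *m lagr_hess g lt y) v].
Proof.
move=> t0 tU vU vsU nk.
have PU : ProperFilter U := ultra_proper.
pose y_ k := y + t k *: v_ k; pose ys_ k := ys + t k *: vs_ k.
have yU : y_ @ U --> y by exact: (cvg_scaled_perturbation tU vU).
have ysU : ys_ @ U --> ys by exact: (cvg_scaled_perturbation tU vsU).
have [c c0 bnd] := multipliers_bounded g2 mf.
(* Multipliers exist only for normals at points close to y, so they are chosen
   conditionally. *)
pose good k lam := multipliers g (y_ k) (ys_ k) lam /\ `|lam| <= c * `|ys_ k|.
have /choice[lam_ lamP] : forall k, exists lam, (exists lam', good k lam') -> good k lam.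
  move=> k; have [[lam gl]|no] := pselect (exists lam', good k lam').
    by exists lam.
  by exists 0 => /no.
have goodU : \forall k \near U, good k (lam_ k).
  have : \forall k \near U, forall ys', regnormal (Gamma g) (y_ k) ys' ->
    exists2 lam, multipliers g (y_ k) ys' lam & `|lam| <= c * `|ys'| by exact: (yU _ bnd).
  apply: filterS => k /(_ _ (nk k))[lam lM lb].
  by apply: lamP; exists lam.
have [lt lU] : exists lt : 'rV[R]_l, lam_ @ U --> lt.
  apply: (@ultra_bounded_cvg _ _ _ _ _ _ (c * (`|ys| + 1))).
  have ysb : \forall k \near U, `|ys_ k| <= `|ys| + 1.
    by apply: (cvgr_norm_le _ ysU); rewrite ltrDl.
  near=> k; have [_ lb] : good k (lam_ k) by near: k.
  by rewrite (le_trans lb)// ler_wpM2l//; near: k.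
have liU i : (fun k => lam_ k 0 i) @ U --> lt 0 i.
  exact: (cvg_comp lam_ (fun w : 'rV[R]_l => w 0 i) lU (@coord_continuous _ _ _ 0 i lt)).
have gU i : (fun k => component g i (y_ k)) @ U --> component g i y.
  by apply: (@cvg_comp _ _ _ y_ (component g i) _ _ _ yU); exact: differentiable_continuous.
have grU i : (fun k => ggrad g i (y_ k)) @ U --> ggrad g i y.
  by apply: (@cvg_comp _ _ _ y_ (ggrad g i) _ _ _ yU); exact: differentiable_continuous.
have goodP : \forall k \near U, [/\ Gamma g (y_ k), forall i, 0 <= lam_ k 0 i,
    forall i, lam_ k 0 i != 0 -> active g (y_ k) i
    & \sum_i lam_ k 0 i *: ggrad g i (y_ k) = ys_ k].
  by apply: filterS goodU => k [/(multipliersP _ _ (dg _))].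
have Gy : Gamma g y.
  move=> i; apply: (cvgr_to_le (gU i)); apply: filterS goodP => k [Gk _ _ _].
  exact: Gk.
have lt0 i : 0 <= lt 0 i.
  by apply: (cvgr_to_ge (liU i)); apply: filterS goodP => k [].
have lta i : lt 0 i != 0 -> active g y i.
  move=> li; have : lt 0 i * component g i y = 0.
    apply: (@cvg_unique _ (@Rhausdorff R) (((fun k => lam_ k 0 i * component g i (y_ k))) @ U)).
      exact: (cvgM (liU i) (gU i)).
    apply: cvg_near_cst; apply: filterS goodP => k [_ _ la _].
    have [->|/la gi] := eqVneq (lam_ k 0 i) 0; first by rewrite mul0r.
    by rewrite /component gi mulr0.
  by move/eqP; rewrite mulf_eq0 (negPf li)/= => /eqP.
have ltE : \sum_i lt 0 i *: ggrad g i y = ys.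
  apply: (@cvg_unique _ (@norm_hausdorff _ _) (ys_ @ U)) => //.
  have : (fun k => \sum_i lam_ k 0 i *: ggrad g i (y_ k)) @ U --> \sum_i lt 0 i *: ggrad g i y.
    by apply: cvg_sumr => i _; apply: cvgZ.
  apply: cvg_trans; apply: near_eq_cvg; apply: filterS goodP => k [_ _ _ ->//].
have ltM : multipliers g y ys lt by apply/multipliersP.
have quotU i : (fun k => (t k)^-1 * (component g i (y_ k) - component g i y)) @ U -->
    dotp (ggrad g i y) v.
  by rewrite dotp_grad//; exact: (quot_cvg t0 tU vU (dc i y)).
have Kv : critical_cone g y ys v.
  split.
    apply: (tangent_cone_filter t0 tU vU).
    by apply: filterS goodP => k [].
  rewrite -ltE dotp_suml big1// => i _; rewrite dotpZl.
  have [->|li] := eqVneq (lt 0 i) 0; first by rewrite mul0r.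
  suff -> : dotp (ggrad g i y) v = 0 by rewrite mulr0.
  apply: (@cvg_unique _ (@Rhausdorff R) _ _ _ _ (quotU i)).
  apply: cvg_near_cst; near=> k.
  have [_ _ la _] : [/\ Gamma g (y_ k), forall i, 0 <= lam_ k 0 i,
    forall i, lam_ k 0 i != 0 -> active g (y_ k) i
    & \sum_i lam_ k 0 i *: ggrad g i (y_ k) = ys_ k] by near: k.
  have lk : lam_ k 0 i != 0 by near: k; exact: (cvgr_neq0 _ (liU i)).
  by rewrite /component (lta i li) (la i lk) subrr mulr0.
pose W k := \sum_i ((lam_ k 0 i - lt 0 i) / t k) *: ggrad g i y.
have WU : W @ U --> vs - v *m lagr_hess g lt y.
  rewrite (mul_lagr_hess lt y v g2).
  have : (fun k => vs_ k - \sum_i lam_ k 0 i *: ((t k)^-1 *: (ggrad g i (y_ k) - ggrad g i y)))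
      @ U --> vs - \sum_i lt 0 i *: (v *m hess (component g i) y).
    apply: cvgB => //; apply: cvg_sumr => i _; apply: cvgZ => //.
    rewrite -[v *m _]/(v *m 'J (ggrad g i) y) (diff_jacobian v (dgr i y)).
    exact: (quot_cvg t0 tU vU (dgr i y)).
  apply: cvg_trans; apply: near_eq_cvg; apply: filterS goodP => k [_ _ _ lE].
  have -> : vs_ k = (t k)^-1 *: (ys_ k - ys).
    by rewrite /ys_ addrC addKr scalerA mulVf ?scale1r// gt_eqF.
  rewrite -lE -ltE -sumrB scaler_sumr -sumrB; apply: eq_bigr => i _.
  by apply/rowP => j; rewrite !mxE; field; rewrite gt_eqF.
exists lt; split => //.
  move=> q /(critical_coneP _ (dg y) mf ltM)[ql q0].
  apply: (cvgr_to_le (dotp_cvg WU (cvg_cst q))).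
  have near_i i : \forall k \near U, (lam_ k 0 i - lt 0 i) * dotp (ggrad g i y) q <= 0.
    have [gi|/eqP gi] := eqVneq (g y 0 i) 0.
      have [li|li] := eqVneq (lt 0 i) 0.
        apply: filterS goodP => k [_ lk0 _ _].
        by rewrite li subr0 mulr_ge0_le0// ql.
      near=> k; rewrite q0 ?mulr0//; exists lt => //.
      by rewrite lt_neqAle eq_sym li lt0.
    near=> k.
    have [_ _ la _] : [/\ Gamma g (y_ k), forall i, 0 <= lam_ k 0 i,
      forall i, lam_ k 0 i != 0 -> active g (y_ k) i
      & \sum_i lam_ k 0 i *: ggrad g i (y_ k) = ys_ k] by near: k.
    have gk : component g i (y_ k) != 0.
      by near: k; apply: (cvgr_neq0 _ (gU i)); apply/eqP.
    have -> : lt 0 i = 0 by apply/eqP; apply: contraT => /lta.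
    have -> : lam_ k 0 i = 0 by apply/eqP; apply: contraT => /la /eqP; rewrite (negPf gk).
    by rewrite subrr mul0r.
  apply: filterS (filter_forall _ near_i) => k Hk.
  rewrite dotp_suml; apply: sumr_le0 => i _.
  by rewrite dotpZl mulrAC pmulr_lle0 ?invr_gt0.
move=> mu /(multipliersP _ _ (dg y))[_ mu0 mua muE].
pose E k i := (t k ^+ 2)^-1 *
  (component g i (y_ k) - component g i y - t k * dotp (ggrad g i y) (v_ k)).
have EU i : (fun k => E k i) @ U --> 2^-1 * dotp v (v *m hess (component g i) y).
  exact: (quot2_cvg t0 tU vU (dc i) (dgr i y)).
have SU : (fun k => \sum_i (mu 0 i - lam_ k 0 i) * E k i - dotp (W k) (v_ k)) @ U -->
    \sum_i (mu 0 i - lt 0 i) * (2^-1 * dotp v (v *m hess (component g i) y))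
    - dotp (vs - v *m lagr_hess g lt y) v.
  apply: cvgB; last exact: dotp_cvg.
  apply: cvg_sumr => i _; apply: cvgM => //.
  by apply: cvgB => //; exact: cvg_cst.
have {SU} : \sum_i (mu 0 i - lt 0 i) * (2^-1 * dotp v (v *m hess (component g i) y))
    - dotp (vs - v *m lagr_hess g lt y) v <= 0.
  apply: (cvgr_to_le SU); apply: filterS goodP => k [Gk lk0 la lE].
  have -> : \sum_i (mu 0 i - lam_ k 0 i) * E k i - dotp (W k) (v_ k) =
      (t k ^+ 2)^-1 * \sum_i (mu 0 i - lam_ k 0 i) * (component g i (y_ k) - component g i y).
    have -> : dotp (W k) (v_ k) =
        \sum_i ((lam_ k 0 i - mu 0 i) / t k) * dotp (ggrad g i y) (v_ k).
      have -> : W k = \sum_i ((lam_ k 0 i - mu 0 i) / t k) *: ggrad g i y.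
        apply/eqP; rewrite -subr_eq0 -sumrB.
        rewrite (eq_bigr (fun i => (t k)^-1 *: (mu 0 i *: ggrad g i y - lt 0 i *: ggrad g i y))).
          by rewrite -scaler_sumr sumrB muE ltE subrr scaler0.
        by move=> i _; apply/rowP => j; rewrite !mxE; field; rewrite gt_eqF.
      by rewrite dotp_suml; apply: eq_bigr => i _; rewrite dotpZl.
    rewrite -sumrB mulr_sumr; apply: eq_bigr => i _.
    rewrite /E.
    by field; rewrite gt_eqF.
  rewrite pmulr_rle0 ?invr_gt0 ?exprn_gt0//.
  apply: sumr_le0 => i _; rewrite mulrBl.
  have -> : mu 0 i * (component g i (y_ k) - component g i y) = mu 0 i * component g i (y_ k).
    have [->|/mua gi] := eqVneq (mu 0 i) 0; first by rewrite !mul0r.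
    by rewrite {2}/component gi subr0.
  have -> : lam_ k 0 i * (component g i (y_ k) - component g i y) =
      - (lam_ k 0 i * component g i y).
    have [->|/la gi] := eqVneq (lam_ k 0 i) 0; first by rewrite !mul0r oppr0.
    by rewrite {1}/component gi sub0r mulrN.
  rewrite opprK -[leRHS]addr0 lerD//; apply: mulr_ge0_le0 => //; first exact: Gk.
  exact: Gy.
rewrite subr_le0 => /(ler_wpM2l (ler0n R 2)); apply: le_trans.
have HE lam : dotp v (v *m lagr_hess g lam y) =
    \sum_i lam 0 i * dotp v (v *m hess (component g i) y).
  transitivity (dotp (\sum_i lam 0 i *: (v *m hess (component g i) y)) v).
    by rewrite [LHS]dotpC; congr (dotp _ v); exact: mul_lagr_hess.
  by rewrite dotp_suml; apply: eq_bigr => i _; rewrite dotpZl (dotpC v).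
rewrite le_eqVlt; apply/orP; left; apply/eqP.
transitivity (\sum_i mu 0 i * dotp v (v *m hess (component g i) y)
  - \sum_i lt 0 i * dotp v (v *m hess (component g i) y)).
  by congr (_ - _); [exact: (HE mu)|exact: (HE lt)].
rewrite -sumrB mulr_sumr; apply: eq_bigr => i _.
by move: (dotp _ _) => ?; field.
Unshelve. all: by end_near. Qed.

End NormalConeGraph.

(** * Graphs of complementarity type *)

(** The graph of v |-> v H + N_K(v): for a convex cone K, a vector is normal to K
    at v exactly when it is polar to K and orthogonal to v. *)
Definition complementary_graph {R : realType} {m : nat} (K : set 'rV[R]_m)
    (H : 'M[R]_m) (v vs : 'rV[R]_m) :=
  [/\ K v, forall q, K q -> dotp (vs - v *m H) q <= 0
    & dotp (vs - v *m H) v = 0].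

(** Polarization, available because the cone is closed under addition. *)
Lemma zero_form_on_cone {R : realType} {m : nat} (K : set 'rV[R]_m) (Q : 'M[R]_m) :
  Q^T = Q -> (forall u w, K u -> K w -> K (u + w)) ->
  (forall u, K u -> dotp u (u *m Q) = 0) ->
  forall u w, K u -> K w -> dotp (u *m Q) w = 0.
Proof.
move=> symQ KD Q0 u w Ku Kw.
have := Q0 _ (KD _ _ Ku Kw); rewrite mulmxDl !dotpDl !dotpDr Q0// (Q0 w)//.
rewrite (dotp_mulmxr u) symQ (dotpC w) add0r addr0 => /eqP.
by rewrite -mulr2n mulrn_eq0/= => /eqP.
Qed.

Lemma complementary_graph_change {R : realType} {m : nat} (K : set 'rV[R]_m)
    (A B : 'M[R]_m) (v vs : 'rV[R]_m) : K v ->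
  (forall q, K q -> dotp (v *m (A - B)) q = 0) ->
  (forall q, K q -> dotp (vs - v *m A) q <= 0) -> 0 <= dotp (vs - v *m A) v ->
  complementary_graph K B v vs.
Proof.
move=> Kv AB pol nonneg.
have E q : K q -> dotp (vs - v *m B) q = dotp (vs - v *m A) q.
  by move=> Kq; rewrite -[RHS]addr0 -(AB q Kq) mulmxBr -dotpDl addrA subrK.
split=> // [q Kq|]; first by rewrite E// pol.
by rewrite E//; apply/eqP; rewrite eq_le pol.
Qed.

Lemma mulmx_norm_bound {R : realType} {d p : nat} (u : 'rV[R]_d) (A : 'M[R]_(d, p)) :
  `|u *m A| <= d%:R * (`|u| * `|A|).
Proof.
apply: norm_le_entry => [|j]; first by rewrite !mulr_ge0.
rewrite mxE (le_trans (ler_norm_sum _ _ _))//.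
apply: (@le_trans _ _ (\sum_(i < d) (`|u| * `|A|))).
  apply: ler_sum => i _; rewrite normrM ler_pM// ?entry_le_norm//.
  by rewrite [leRHS]/Num.Def.normr /= mx_normrE; apply: (le_bigmax _ _ (i, j)).
by rewrite sumr_const card_ord mulr_natl.
Qed.

Lemma form_bound {R : realType} {m : nat} (A : 'M[R]_m) :
  exists2 c : R, 0 <= c & forall h : 'rV_m, `|dotp h (h *m A)| <= c * dotp h h.
Proof.
exists (m%:R * (m%:R * `|A|)) => [|h]; first by rewrite !mulr_ge0.
rewrite (le_trans (dotp_bound _ _))// -mulrA ler_wpM2l//.
apply: (@le_trans _ _ (m%:R * `|A| * `|h| ^+ 2)); last first.
  by rewrite ler_wpM2l ?mulr_ge0// norm_sqr_le_dotp.
rewrite (le_trans (ler_wpM2l (normr_ge0 _) (mulmx_norm_bound _ _)))//.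
by rewrite le_eqVlt; apply/orP; left; apply/eqP; ring.
Qed.

Lemma cvg_row_mx {R : realType} {d p : nat} {T : Type} {F : set_system T}
    {FF : Filter F} (f : T -> 'rV[R]_d) (h : T -> 'rV[R]_p) (u : 'rV[R]_d) (v : 'rV[R]_p) :
  f @ F --> u -> h @ F --> v -> (fun k => row_mx (f k) (h k)) @ F --> row_mx u v.
Proof.
move=> fu hv.
have E (a : 'rV[R]_d) (b : 'rV[R]_p) :
    row_mx a b = a *m row_mx 1%:M 0 + b *m row_mx 0 1%:M.
  by rewrite !mul_mx_row !mulmx1 !mulmx0 add_row_mx addr0 add0r.
rewrite E; have -> : (fun k => row_mx (f k) (h k)) =
    (fun k => f k *m row_mx 1%:M 0 + h k *m row_mx 0 1%:M) by apply/funext.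
have c d' (A : 'M[R]_(d', d + p)) w : {for w, continuous (mulmxr A : 'rV[R]_d' -> _)}.
  by apply: differentiable_continuous; have [] := is_diff_mulmxr A w.
apply: cvgD.
  exact: (cvg_comp f (mulmxr (row_mx 1%:M 0) : 'rV[R]_d -> _) fu (c _ _ u)).
exact: (cvg_comp h (mulmxr (row_mx 0 1%:M) : 'rV[R]_p -> _) hv (c _ _ v)).
Qed.

Section TangentToNormalGraph.
Context {R : realType} {m l : nat} (g : 'rV[R]_m -> 'rV[R]_l).
Context (y ys vh : 'rV[R]_m) (lam : 'rV[R]_l) (g2 : C2 g) (mf : mfcq g y vh).
Context (lamM : multipliers g y ys lam).
Context (lam_dir : forall v mu, critical_cone g y ys v -> v != 0 ->
  dir_multipliers g y ys v mu ->
  forall w, critical_cone g y ys w -> dotp w (w *m lagr_hess g mu y) =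
     dotp w (w *m lagr_hess g lam y)).

Let dg z : differentiable g z. Proof. exact: g2.1.1. Qed.
Let K := critical_cone g y ys.

Lemma critical_coneD v w : K v -> K w -> K (v + w).
Proof.
move=> /(critical_coneP _ (dg y) mf lamM)[v1 v2].
move=> /(critical_coneP _ (dg y) mf lamM)[w1 w2].
apply/(critical_coneP _ (dg y) mf lamM); split=> i hi; rewrite dotpDr.
  by rewrite -(addr0 0) lerD// ?v1 ?w1.
by rewrite v2// w2// addr0.
Qed.

(** The limit multiplier mu is a maximizer in the direction v, so by [lam_dir] the
    quadratic forms of the two Lagrangian Hessians coincide on the critical cone,
    and by polarization so do v (hess mu) and v (hess lam) as functionals on it.
    For v = 0 both vanish. *)
Lemma normal_quotient_limit_graph {T : Type} {U : set_system T} {UU : UltraFilter U}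
    (t : T -> R) (v_ vs_ : T -> 'rV[R]_m) (v vs : 'rV[R]_m) :
  (forall k, 0 < t k) -> t @ U --> 0 -> v_ @ U --> v -> vs_ @ U --> vs ->
  (forall k, regnormal (Gamma g) (y + t k *: v_ k) (ys + t k *: vs_ k)) ->
  complementary_graph K (lagr_hess g lam y) v vs.
Proof.
move=> t0 tU vU vsU nk.
have [mu [muM Kv pol sup]] := normal_quotient_limit g2 mf t0 tU vU vsU nk.
have agree q : K q -> dotp (v *m (lagr_hess g mu y - lagr_hess g lam y)) q = 0.
  move=> Kq; have [v0|v0] := eqVneq v 0; first by rewrite v0 mul0mx dotp0l.
  have dirmu : dir_multipliers g y ys v mu.
    split=> [|nu nuM]; first exact: muM.
    rewrite -subr_le0; apply: (le_trans (sup nu nuM)).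
    by rewrite pmulr_rle0//; exact: pol.
  apply: (@zero_form_on_cone _ _ K _ _ _ _ v q Kv Kq) => [||w Kw].
  - rewrite raddfB/=; congr (_ - _); exact: lagr_hess_sym.
  - exact: critical_coneD.
  - rewrite mulmxBr dotpBr; apply/eqP; rewrite subr_eq0; apply/eqP.
    exact: lam_dir Kv v0 dirmu w Kw.
have nonneg : 0 <= dotp (vs - v *m lagr_hess g mu y) v.
  by have := sup _ muM; rewrite subrr pmulr_rge0.
exact: (complementary_graph_change Kv agree pol nonneg).
Qed.

(** The Lagrangian is nonpositive on Gamma and vanishes at y, where its gradient is
    ys; expand it to second order. *)
Lemma multiplier_quadratic_bound : exists2 c : R, 0 <= c & exists2 r : R, 0 < r &
  forall h, `|h| < r -> Gamma g (y + h) -> dotp ys h <= c * dotp h h.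
Proof.
have [_ l0 la lE] := (multipliersP _ _ (dg y)).1 lamM.
pose L z := dotp lam (g z).
have dL z : differentiable L z := (lagrangian_differentiable lam (dg z)).1.
have gradL z : grad L z = \sum_i lam 0 i *: ggrad g i z.
  exact: (lagrangian_differentiable lam (dg z)).2.
have dgL : differentiable (grad L) y.
  have -> : grad L = \sum_i (lam 0 i *: ggrad g i).
    by apply/funext => z; rewrite gradL fct_sumE.
  by apply: differentiable_sum => i; apply: differentiableZ; exact: (g2.2 i).1.
have [r r0 rP] := taylor2 dL dgL ltr01.
have [c c0 cP] := form_bound (hess L y).
exists (1 + c); first by rewrite addr_ge0.
exists r => // h /rP; rewrite mul1r gradL lE => hr Gh.
have Ly : L y = 0.
  rewrite /L /dotp big1// => i _; have [->|/la ->] := eqVneq (lam 0 i) 0.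
    by rewrite mul0r.
  by rewrite mulr0.
have Lh : L (y + h) <= 0.
  by apply: sumr_le0 => i _; rewrite mulr_ge0_le0.
move: hr; rewrite Ly subr0 => /ler_normlP[hr _].
have := cP h; move=> /ler_normlP[ch _].
have := norm_sqr_le_dotp h; have := dotp_ge0 h; have cN := mulr_ge0 c0 (dotp_ge0 h).
move: (dotp h (h *m _)) (dotp h h) (`|h| ^+ 2) cN ch hr Lh => A B D.
by rewrite mulrDl; lra.
Qed.

End TangentToNormalGraph.

(** * The tangent cone to the graph of the normal cone mapping *)

(** The graph of v |-> v H + rho v + N_K(v) is strongly monotone once rho
    exceeds the form of H, so v is determined by its image. *)
Lemma complementary_graph_monotone {R : realType} {m : nat} (K : set 'rV[R]_m)
    (H : 'M[R]_m) (c rho : R) (u v vs : 'rV[R]_m) :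
  (forall h : 'rV_m, `|dotp h (h *m H)| <= c * dotp h h) -> c < rho ->
  complementary_graph K H v vs ->
  complementary_graph K H u (vs - rho *: (u - v)) -> u = v.
Proof.
move=> cH crho [Kv va vv] [Ku ub uu].
apply/eqP; rewrite -subr_eq0; apply/eqP; apply: dotp_eq0.
have au := va u Ku; have bv := ub v Kv.
have := cH (u - v); set N := dotp (u - v) (u - v) => /ler_normlP[cN _].
have mono : 0 <= - rho * N - dotp (u - v) ((u - v) *m H).
  have -> : - rho * N - dotp (u - v) ((u - v) *m H) =
      dotp ((vs - rho *: (u - v) - u *m H) - (vs - v *m H)) (u - v).
    have -> : (vs - rho *: (u - v) - u *m H) - (vs - v *m H) =
        - rho *: (u - v) - (u - v) *m H.
      by rewrite mulmxBl scaleNr; apply/rowP => j; rewrite !mxE; ring.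
    by rewrite [RHS]dotpBl dotpZl (dotpC (_ *m H)).
  by rewrite dotpBl !dotpBr uu vv subr0 sub0r subr_ge0 (le_trans au)// oppr_ge0.
have : (rho - c) * N <= 0 by rewrite mulrBl; lra.
by rewrite pmulr_rle0// subr_gt0.
Qed.

Section ProximalNormals.
Context {R : realType} {d : nat}.
Implicit Types (Theta : set 'rV[R]_d) (z p v w h : 'rV[R]_d).

Lemma proximal_regnormal Theta z p (k r : R) : 0 < r -> Theta z ->
  (forall h, `|h| < r -> Theta (z + h) -> dotp p h <= k * dotp h h) ->
  regnormal Theta z p.
Proof.
move=> r0 Tz prox; split=> // u [t [u_ [t0 tF uF Tu]]].
have lim0 : (fun i => k * (t i * dotp (u_ i) (u_ i))) @ \oo --> (0 : R).
  rewrite -(mulr0 k) -(mul0r (dotp u u)).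
  by apply: cvgMr; apply: cvgM => //; exact: dotp_cvg.
have pu : (fun i => dotp p (u_ i) - k * (t i * dotp (u_ i) (u_ i))) @ \oo -->
    dotp p u.
  rewrite -[dotp p u]subr0; apply: cvgB lim0.
  by apply: dotp_cvg => //; exact: cvg_cst.
apply: (cvgr_to_le pu).
have small : \forall i \near \oo, `|t i *: u_ i| < r /\ `|u_ i| <= `|u| + 1.
  exact: near_scaled_small.
apply: filterS small => i [ti _].
have := prox _ ti (Tu i); rewrite dotpZl !dotpZr => le.
rewrite subr_le0 -(ler_pM2l (t0 i)) (le_trans le)//.
by rewrite le_eqVlt; apply/orP; left; apply/eqP; ring.
Qed.

Lemma closed_translate Theta z : closed Theta -> closed [set h | Theta (z + h)].
Proof.
move=> cT; apply: (@closed_comp _ _ (fun h => z + h)) => // h _.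
by apply: (@continuousD _ _ _ (fun=> z) id); [exact: cst_continuous|exact: cvg_id].
Qed.

(** Minimize phi(h) = - <zs + t w, h> + rho/2 |h - t v|^2 over the h in a small
    ball with z + h in Theta. Comparison with h = 0, together with the quadratic
    bound on zs, shows that a minimizer has norm at most t M; so it is interior
    to the ball for small t, and optimality says that minus the gradient of phi
    is a proximal normal there. *)
Lemma nearby_normals Theta z zs v w (c r rho : R) :
  closed Theta -> Theta z -> 0 <= c -> 0 < r ->
  (forall h, `|h| < r -> Theta (z + h) -> dotp zs h <= c * dotp h h) ->
  2 * (c + 1) <= rho ->
  exists2 M : R, 0 <= M & exists2 t1 : R, 0 < t1 & forall t, 0 < t -> t < t1 ->
    exists2 u, `|u| <= M &
      regnormal Theta (z + t *: u) (zs + t *: (w - rho *: (u - v))).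
Proof.
move=> cT Tz c0 r0 low rhoc.
have rho0 : 0 <= rho by lra.
pose M := d%:R * `|w + rho *: v|.
have M0 : 0 <= M by rewrite mulr_ge0.
exists M => //; exists (r / 2 / (M + 1)); first by rewrite !divr_gt0// ltr_wpDl.
move=> t t0; rewrite ltr_pdivlMr ?ltr_wpDl// => tM.
pose A := [set h | Theta (z + h)] `&` [set h : 'rV[R]_d | `|h| <= r / 2].
have cA : compact A.
  rewrite /A setIC; apply: compact_closedI; first exact: compact_norm_ball.
  exact: closed_translate.
pose phi h := - dotp (zs + t *: w) h + rho / 2 * dotp (h - t *: v) (h - t *: v).
have cphi : continuous phi.
  move=> h.
  have idh : id @ h --> h by exact: cvg_id.
  have hv : (fun k : 'rV[R]_d => k - t *: v) @ h --> h - t *: v.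
    exact (cvgB idh (cvg_cst (t *: v))).
  have qC : (fun _ : 'rV[R]_d => zs + t *: w) @ h --> zs + t *: w.
    exact (@cvg_cst _ (zs + t *: w) _ (nbhs h) (nbhs_filter h)).
  have dot_h := @dotp_cvg R d _ (nbhs h) (nbhs_filter h).
  exact (cvgD (cvgN (dot_h _ _ _ _ qC idh))
    (cvgM (cvg_cst (rho / 2)) (dot_h _ _ _ _ hv hv))).
have A0 : A 0.
  by split => /=; rewrite ?addr0// normr0 divr_ge0// ltW.
have [h + hmin] := compact_EVT_min (ex_intro _ 0 A0) cA (continuous_subspaceT cphi).
rewrite inE => -[Th hr].
have hmin' k : A k -> phi h <= phi k by move=> Ak; apply: hmin; rewrite inE.
have hrr : `|h| < r by rewrite (le_lt_trans hr)// ltr_pdivrMr// ltr_pMr// ltr1n.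
have h0 := hmin' _ A0.
have lowh := low h hrr Th.
have normh : `|h| <= t * M.
  have le1 : dotp h h <= t * dotp (w + rho *: v) h.
    move: h0 lowh; rewrite /phi !(dotpDl, dotpBl, dotpBr, dotpNl, dotpZl, dotpZr, dotp0l, dotp0r).
    have := dotp_ge0 h; rewrite (dotpC h v).
    move: (dotp h h) (dotp v h) (dotp w h) (dotp zs h) (dotp v v) => a b e f k.
    move=> a0 H1 H2.
    have : (rho / 2 - c) * a <= t * (e + rho * b) by lra.
    have : 1 * a <= (rho / 2 - c) * a by rewrite ler_wpM2r//; lra.
    by rewrite mul1r; apply: le_trans.
  have le2 : `|h| ^+ 2 <= t * M * `|h|.
    rewrite (le_trans (norm_sqr_le_dotp _))// (le_trans le1)// -mulrA ler_pM2l//.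
    by rewrite (le_trans (ler_norm _))// (le_trans (dotp_bound _ _))// /M mulrA.
  have [->|hn] := eqVneq h 0; first by rewrite normr0 mulr_ge0// ltW.
  by rewrite -(ler_pM2r (_ : 0 < `|h|)) ?normr_gt0// -expr2.
have hlt : `|h| < r / 2.
  by rewrite (le_lt_trans normh)// (le_lt_trans _ tM)// ler_pM2l// lerDl.
exists (t^-1 *: h).
  by rewrite normrZ normfV gtr0_norm// ler_pdivrMl.
rewrite scalerA mulfV ?gt_eqF// scale1r.
apply: (@proximal_regnormal _ _ _ (rho / 2) (r / 2 - `|h|)) => //.
  by rewrite subr_gt0.
move=> k kr Tk.
have Ahk : A (h + k).
  split; rewrite /= ?addrA// (le_trans (ler_normD _ _))//.
  by rewrite -lerBrDl ltW.
have := hmin' _ Ahk; rewrite /phi.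
have -> : zs + t *: (w - rho *: (t^-1 *: h - v)) = zs + t *: w - rho *: (h - t *: v).
  by apply/rowP => j; rewrite !mxE; field; rewrite gt_eqF.
have -> : h + k - t *: v = k + (h - t *: v) by rewrite addrAC addrC.
move: (h - t *: v) (zs + t *: w) => hv q.
rewrite !(dotpDl, dotpDr, dotpBl, dotpNl, dotpZl) (dotpC k hv).
move: (dotp k k) (dotp hv k) (dotp hv hv) (dotp q h) (dotp q k) => a b e f o.
by lra.
Qed.

End ProximalNormals.

Section TangentToNormalGraph.
Context {R : realType} {m l : nat} (g : 'rV[R]_m -> 'rV[R]_l).
Context (y ys vh : 'rV[R]_m) (lam : 'rV[R]_l) (g2 : C2 g) (mf : mfcq g y vh).
Context (lamM : multipliers g y ys lam).
Context (lam_dir : forall v mu, critical_cone g y ys v -> v != 0 ->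
  dir_multipliers g y ys v mu ->
  forall w, critical_cone g y ys w -> dotp w (w *m lagr_hess g mu y) =
     dotp w (w *m lagr_hess g lam y)).

Let dg z : differentiable g z. Proof. exact: g2.1.1. Qed.

Lemma Gamma_closed : closed (Gamma g).
Proof.
have -> : Gamma g = \bigcap_(i in [set: 'I_l]) [set z | component g i z <= 0].
  by apply/seteqP; split=> z Gz => [i _|i]; [exact: Gz|exact: (Gz i)].
apply: closed_bigI => i _.
apply: (@closed_comp _ _ (component g i) [set s | s <= 0]) => [z _|].
  exact/differentiable_continuous/component_differentiable.
exact: closed_le.
Qed.

(** If (v, vs) belongs to the graph on the right, [nearby_normals] yields normals
    along directions u_ k. Their limit u satisfies, by the first implication, the
    same relation with vs - rho (u - v) in place of vs, and monotonicity gives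
    u = v. *)
Lemma tangent_gph_normal v vs :
  tangent_cone (gph_normal g) (row_mx y ys) (row_mx v vs) <->
  complementary_graph (critical_cone g y ys) (lagr_hess g lam y) v vs.
Proof.
have [U [UU oU]] := @ultraFilterLemma _ (\oo : set_system nat) _.
have PU : ProperFilter U by exact: ultra_proper.
have toU (V : topologicalType) (f : nat -> V) (a : V) : f @ \oo --> a -> f @ U --> a.
  by move=> fa B Ba; exact: (oU _ (fa B Ba)).
split=> [[t [w_ [t0 /toU tU /toU wU Gw]]]|cg].
  have vU : (fun k => lsubmx (w_ k)) @ U --> v.
    rewrite -[v](row_mxKl v vs).
    exact: (cvg_comp w_ lsubmx wU (@continuous_lsubmx _ _ _ _ (row_mx v vs))).
  have vsU : (fun k => rsubmx (w_ k)) @ U --> vs.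
    rewrite -[vs](row_mxKr v vs).
    exact: (cvg_comp w_ rsubmx wU (@continuous_rsubmx _ _ _ _ (row_mx v vs))).
  apply: (normal_quotient_limit_graph g2 mf lamM lam_dir t0 tU vU vsU) => k.
  have := Gw k; rewrite /gph_normal /= -[w_ k]hsubmxK scale_row_mx add_row_mx.
  by rewrite !row_mxKl !row_mxKr.
have [c c0 [r r0 low]] := multiplier_quadratic_bound g2 lamM.
have [c' c'0 cH] := form_bound (lagr_hess g lam y).
have [Gy _ _ _] := (multipliersP _ _ (dg y)).1 lamM.
(* Large enough both for [nearby_normals] and for strong monotonicity. *)
pose rho := 2 * (c + 1) + c' + 1.
have [|M M0 [t1 t10 near_n]] := @nearby_normals _ _ _ _ _ v vs c r rho Gamma_closed Gy c0 r0 low.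
  by rewrite /rho; lra.
pose t k : R := t1 / 2 * harmonic k.
have t0 k : 0 < t k by rewrite /t mulr_gt0 ?divr_gt0// /harmonic invr_gt0.
have tt1 k : t k < t1.
  rewrite /t -mulrA gtr_pMr// -ltr_pdivlMl// invrK mulr1 (@le_lt_trans _ _ 1)//.
    by rewrite /harmonic invf_le1 ?ler1n// ltr0n.
  by rewrite ltr1n.
have tF : t @ \oo --> 0.
  by rewrite -(mulr0 (t1 / 2)); apply: cvgMr; exact: cvg_harmonic.
have /choice[u_ uP] : forall k, exists u, `|u| <= M /\
    regnormal (Gamma g) (y + t k *: u) (ys + t k *: (vs - rho *: (u - v))).
  by move=> k; have [u uM nu] := near_n _ (t0 k) (tt1 k); exists u.
have ub : \forall k \near U, `|u_ k| <= M by apply: nearW => k; exact: (uP k).1.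
have [u uU] := @ultra_bounded_cvg _ _ _ U _ u_ M ub.
pose w_ k := vs - rho *: (u_ k - v).
have wU : w_ @ U --> vs - rho *: (u - v).
  apply: cvgB; first exact: cvg_cst.
  apply: cvgZ; first exact: cvg_cst.
  by apply: cvgB => //; exact: cvg_cst.
have cgu : complementary_graph (critical_cone g y ys) (lagr_hess g lam y) u
    (vs - rho *: (u - v)).
  exact: (normal_quotient_limit_graph g2 mf lamM lam_dir t0 (toU _ _ _ tF) uU wU
    (fun k => (uP k).2)).
have uv : u = v.
  have crho : c' < rho by rewrite /rho; lra.
  refine (complementary_graph_monotone cH crho cg cgu).
rewrite uv subrr scaler0 subr0 in uU wU.
apply: (tangent_cone_filter t0 (toU _ _ _ tF) (cvg_row_mx uU wU)).
apply: nearW => k; rewrite /gph_normal /= scale_row_mx add_row_mx row_mxKl row_mxKr.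
exact: (uP k).2.
Qed.

End TangentToNormalGraph.

(** * Faces of the linearized problem *)

(** Along the ray through u an inequality <a i, u> <= b i survives scaling only if
    <a i, u> <= 0. *)
Lemma polyhedral_cone {R : realType} {d : nat} (K : set 'rV[R]_d) :
  K 0 -> (forall (s : R) u, 0 < s -> K u -> K (s *: u)) -> polyhedral K ->
  exists (p : nat) (a : 'I_p -> 'rV[R]_d),
    K = [set u | forall i, dotp (a i) u <= 0].
Proof.
move=> K0 KZ [p [a [b KE]]].
exists p, a; apply/seteqP; split=> u; last first.
  move=> au; rewrite KE => i; apply: (le_trans (au i)).
  by move: K0; rewrite KE => /(_ i); rewrite dotp0r.
move=> Ku i; rewrite leNgt; apply/negP => ai0.
have b0 : 0 <= b i by move: K0; rewrite KE => /(_ i); rewrite dotp0r.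
have s0 : 0 < (b i + 1) / dotp (a i) u by rewrite divr_gt0// ltr_wpDl.
have := KZ _ _ s0 Ku; rewrite KE => /(_ i).
by rewrite dotpZr divfK ?gt_eqF// gerDl ler10.
Qed.

Section CriticalFaces.
Context {R : realType} {n m l p : nat}.
Context (TC : set 'rV[R]_n) (a : 'I_p -> 'rV[R]_n) (gr : 'I_l -> 'rV[R]_m).
Context (Jx : 'M[R]_(n, m)) (Jy H : 'M[R]_m) (I Ip : set 'I_l).
Context (TCE : TC = [set u | forall i, dotp (a i) u <= 0]).

(** Farkas's lemma in the variables (u, v, mu). The vector - q collects the
    coefficients of the system - (u Jx + v Jy) = v H + sum_i mu_i gr_i, the
    multipliers of the conclusion are those of the constraints on v, and the
    coefficients of the sign constraints on mu give the conditions on q. *)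
Lemma face_polar (beta : set 'I_l) (xi1 : 'rV[R]_n) (xi2 : 'rV[R]_m) :
  H^T = H -> Ip `<=` I -> beta `<=` I ->
  (forall u v (mu : 'I_l -> R), TC u ->
     (forall i, (Ip `|` beta) i -> dotp (gr i) v = 0) ->
     (forall i, I i -> dotp (gr i) v <= 0) ->
     (forall i, beta i -> ~ Ip i -> 0 <= mu i) ->
     (forall i, ~ (Ip `|` beta) i -> mu i = 0) ->
     - (u *m Jx + v *m Jy) = v *m H + \sum_i mu i *: gr i ->
     dotp xi1 u + dotp xi2 v <= 0) ->
  exists eta q (mu : 'I_l -> R), [/\ polar TC eta,
    xi1 = eta - q *m Jx^T,
    xi2 + q *m Jy^T + q *m H = \sum_(i in I) mu i *: gr i,
    forall i, Ip i -> dotp (gr i) q = 0 &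
    (forall i, beta i -> ~ Ip i -> dotp (gr i) q <= 0) /\
    (forall i, ~ (Ip `|` beta) i -> 0 <= mu i)].
Proof.
move=> symH IpI bI Hxi.
(* Inactive indices carry no constraint on v. *)
pose gr' i := if i \in I then gr i else 0.
(* Constraints: membership of u in TC, the gradients on v, the signs of mu
   (void on Ip, where mu is free), and the linear system. *)
pose T := ('I_p + ('I_l + ('I_l + 'I_m)))%type.
pose A (k : T) : 'rV[R]_(n + (m + l)) := match k with
  | inl i => row_mx (a i) 0
  | inr (inl i) => row_mx 0 (row_mx (gr' i) 0)
  | inr (inr (inl i)) => row_mx 0 (row_mx 0 (if i \in Ip then 0 else - delta_mx 0 i))
  | inr (inr (inr j)) => row_mx (delta_mx 0 j *m Jx^T)
      (row_mx (delta_mx 0 j *m (Jy + H)^T) (\row_i gr i 0 j)) end.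
pose E : set T := [set k | match k with
  | inl i => False
  | inr (inl i) => (Ip `|` beta) i
  | inr (inr (inl i)) => ~ (Ip `|` beta) i
  | inr (inr (inr j)) => True end].
have AE (k : T) u v (mu : 'rV[R]_l) : dotp (A k) (row_mx u (row_mx v mu)) =
    match k with
    | inl i => dotp (a i) u
    | inr (inl i) => dotp (gr' i) v
    | inr (inr (inl i)) => if i \in Ip then 0 else - mu 0 i
    | inr (inr (inr j)) => (u *m Jx + v *m (Jy + H) + \sum_i mu 0 i *: gr i) 0 j
    end.
  case: k => [i|[i|[i|j]]] /=; rewrite !dotp_row_mx ?dotp0l ?addr0 ?add0r//.
    by case: ifP => _; rewrite ?dotp0l// dotpNl dotpC dotp_delta.
  rewrite -!dotp_mulmxr !(dotpC (delta_mx 0 j)) !dotp_delta addrA [RHS]mxE [X in _ = X + _]mxE.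
  congr (_ + _); rewrite summxE; apply: eq_bigr => i _.
  by rewrite !mxE mulrC.
have [X eqX leX|c c0 bE] := @farkas R _ T E A (row_mx xi1 (row_mx xi2 0)).
  rewrite -(hsubmxK X) -(hsubmxK (rsubmx X)) in eqX leX *.
  set u := lsubmx X in eqX leX *; set v := lsubmx (rsubmx X) in eqX leX *.
  set mu := rsubmx (rsubmx X) in eqX leX *.
  rewrite !dotp_row_mx dotp0l addr0.
  have grE i : I i -> gr' i = gr i by move=> Ii; rewrite /gr' mem_set.
  apply: (Hxi u v (fun i => mu 0 i)).
  - by rewrite TCE => i; have := leX (inl i); rewrite AE.
  - move=> i Bi; have := eqX (inr (inl i)) Bi; rewrite AE grE//.
    by case: Bi => [/IpI|/bI].
  - by move=> i Ii; have := leX (inr (inl i)); rewrite AE grE.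
  - move=> i bi nIp; have := leX (inr (inr (inl i))); rewrite AE.
    by rewrite memNset// oppr_le0.
  - move=> i nB; have := eqX (inr (inr (inl i))) nB; rewrite AE.
    rewrite memNset; last by move=> Ipi; apply: nB; left.
    by move/eqP; rewrite oppr_eq0 => /eqP.
  - have S0 : u *m Jx + v *m (Jy + H) + \sum_i mu 0 i *: gr i = 0.
      apply/rowP => j; rewrite [RHS]mxE.
      by have := eqX (inr (inr (inr j))) Logic.I; rewrite AE.
    move/eqP: S0; rewrite mulmxDr addrA -(addrA (u *m Jx + _)) addr_eq0 => /eqP->.
    by rewrite opprK.
have key u v (mu : 'rV[R]_l) : dotp xi1 u + dotp xi2 v =
    \sum_i c (inl i) * dotp (a i) u + (\sum_i c (inr (inl i)) * dotp (gr' i) v +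
    (\sum_i c (inr (inr (inl i))) * (if i \in Ip then 0 else - mu 0 i) +
     \sum_j c (inr (inr (inr j))) *
        (u *m Jx + v *m (Jy + H) + \sum_i mu 0 i *: gr i) 0 j)).
  have -> : dotp xi1 u + dotp xi2 v =
      dotp (row_mx xi1 (row_mx xi2 0)) (row_mx u (row_mx v mu)).
    by rewrite !dotp_row_mx dotp0l addr0.
  rewrite bE dotp_suml (eq_bigr _ (fun k _ => dotpZl (c k) (A k) _)).
  rewrite !big_sumType; congr (_ + (_ + (_ + _))); apply: eq_bigr => i _;
    by congr (_ * _); rewrite AE.
pose q : 'rV[R]_m := - \row_j c (inr (inr (inr j))).
have qE (w : 'rV[R]_m) : \sum_j c (inr (inr (inr j))) * w 0 j = - dotp q w.
  rewrite /q dotpNl opprK; apply: eq_bigr => j _; by rewrite mxE.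
pose mu i := c (inr (inl i)).
have Z1 : \sum_i c (inl i) * dotp (a i) 0 = 0.
  by rewrite big1// => i _; rewrite dotp0r mulr0.
have Z2 : \sum_i c (inr (inl i)) * dotp (gr' i) 0 = 0.
  by rewrite big1// => i _; rewrite dotp0r mulr0.
have Z3 : \sum_i c (inr (inr (inl i))) *
    (if i \in Ip then 0 else - (0 : 'rV[R]_l) 0 i) = 0.
  by rewrite big1// => i _; rewrite mxE oppr0 if_same mulr0.
have Z4 : \sum_i (0 : 'rV[R]_l) 0 i *: gr i = 0.
  by rewrite big1// => i _; rewrite mxE scale0r.
have gradq i : dotp (gr i) q = - (if i \in Ip then 0 else c (inr (inr (inl i)))).
  have := key 0 0 (delta_mx 0 i).
  rewrite Z1 Z2 qE !mul0mx !dotp0r !add0r (bigD1 i)//= big1 => [|k ki]; last first.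
    by rewrite mxE (negPf ki) andbF oppr0 if_same mulr0.
  rewrite [X in dotp q X](bigD1 i)//= [X in dotp q (_ + X)]big1 => [|k ki]; last first.
    by rewrite mxE (negPf ki) andbF scale0r.
  rewrite !mxE !eqxx scale1r !addr0 dotpC.
  by case: ifP => _; rewrite ?mulr0 ?mulrN1; lra.
exists (\sum_i c (inl i) *: a i), q, mu; split.
- move=> u; rewrite TCE => au; rewrite dotp_suml; apply: sumr_le0 => i _.
  by rewrite dotpZl mulr_ge0_le0// c0.
- apply: dotp_inj => u; have := key u 0 0; rewrite dotp0r addr0 qE => ->.
  rewrite Z2 Z3 Z4 mul0mx !addr0 !add0r dotpBl dotp_suml dotp_mulmxr.
  by congr (_ + _); apply: eq_bigr => i _; rewrite dotpZl.
- apply: dotp_inj => v; have := key 0 v 0; rewrite dotp0r add0r qE.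
  rewrite Z1 Z3 Z4 mul0mx !addr0 !add0r !dotpDl => ->.
  rewrite mulmxDr dotpDr !(dotp_mulmxr q) symH.
  set S := \sum_i _; set Y := dotp _ v; set Z := dotp _ v.
  have -> : S - (Y + Z) + Y + Z = S by ring.
  rewrite dotp_suml [RHS]big_mkcond; apply: eq_bigr => i _.
  by rewrite /gr' /mu; case: ifP; rewrite ?dotpZl// dotp0l mulr0.
- by move=> i Ipi; rewrite gradq mem_set// oppr0.
- split=> [i bi nIp|i nB]; last by apply: c0; rewrite /E /=.
  by rewrite gradq memNset// oppr_le0 c0//= => nB; apply: nB; right.
Qed.

End CriticalFaces.

(** * The two formulas for the regular normal cone *)

Lemma mul_JmapFT {R : realType} {n m : nat} (G : 'rV[R]_(n + m) -> 'rV[R]_m)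
    (x eta : 'rV[R]_n) (y qs q : 'rV[R]_m) : differentiable G (row_mx x y) ->
  row_mx eta (row_mx qs q) *m ('J (mapF G) (row_mx x y))^T =
  row_mx (eta - q *m (Jx G x y)^T) (qs - q *m (Jy G x y)^T).
Proof.
move=> dG; apply: dotp_inj => w; rewrite -(hsubmxK w).
move: (lsubmx w) (rsubmx w) => u v.
rewrite -dotp_mulmxr mul_JmapF// !dotp_row_mx dotpNr dotpDr !dotp_mulmxr !dotpBl.
by ring.
Qed.

(** Both the transpose of Jy + H and that of Jx are known on r: the first gives a
    combination of gradients, the second a difference of two normals, which
    vanishes on the lineality space. *)
Lemma shift_pairing {R : realType} {n m l : nat} (TC : set 'rV[R]_n)
    (Jx : 'M[R]_(n, m)) (Jy H : 'M[R]_m) (gr : 'I_l -> 'rV[R]_m) (I : set 'I_l)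
    (r : 'rV[R]_m) (mur : 'I_l -> R) (eta nu lj : 'rV[R]_n) :
  H^T = H -> r *m Jy^T + r *m H = \sum_(i in I) mur i *: gr i ->
  polar TC eta -> polar TC nu -> eta = r *m Jx^T + nu -> lineality TC lj ->
  forall zj, dotp (zj *m (Jy + H) - lj *m Jx) r = \sum_(i in I) mur i * dotp (gr i) zj.
Proof.
move=> symH rE Teta Tnu etaE [lT lNT] zj.
have lin0 w : polar TC w -> dotp w lj = 0.
  move=> Tw; apply/eqP; rewrite eq_le Tw//= -oppr_le0 -dotpNr; exact: Tw.
have -> : dotp (zj *m (Jy + H) - lj *m Jx) r = dotp (zj *m (Jy + H)) r.
  rewrite dotpBl (dotp_mulmxl lj).
  have -> : r *m Jx^T = eta - nu by rewrite etaE addrK.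
  by rewrite (dotpC lj) dotpBl !lin0// !subr0.
rewrite dotp_mulmxl raddfD/= symH mulmxDr rE dotpC dotp_suml.
by apply: eq_bigr => i _; rewrite dotpZl.
Qed.

Unset Implicit Arguments.

Theorem theorem11 (R : realType) (n m l : nat)
    (G : 'rV[R]_(n + m) -> 'rV[R]_m) (C : set 'rV[R]_n)
    (g : 'rV[R]_m -> 'rV[R]_l) (x : 'rV[R]_n) (y : 'rV[R]_m)
    (lam : 'rV[R]_l) (beta1 beta2 : set 'I_l) :
  let z := row_mx x y in
  let ys : 'rV[R]_m := - G z in
  let TC := tangent_cone C x in
  let I := active g y in
  let Ip := Iplus g y ys in
  let I0 := Izero g y ys in
  let K := critical_cone g y ys in
  let H := lagr_hess g lam y in
  C1 G -> closed C -> C2 g ->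
  OmegaGE G C g z ->
  convex_set (TC : set (convex_lmodType 'rV[R]_n)) ->
  tangent_cone (setDGE C g) (mapF G z) =
    [set w | TC (lsubmx w) /\
             tangent_cone (gph_normal g) (row_mx y (- G z)) (rsubmx w)] ->
  GGCQ G C g z ->
  (exists v : 'rV[R]_m, forall i, I i -> dotp (ggrad g i y) v < 0) ->
  polyhedral TC ->
  (forall v1 v2, K v1 -> v1 != 0 -> K v2 -> v2 != 0 ->
     dir_multipliers g y ys v1 = dir_multipliers g y ys v2) ->
  (K <> [set 0] -> exists v, [/\ K v, v != 0 & dir_multipliers g y ys v lam]) ->
  (K = [set 0] -> multipliers g y ys lam) ->
  beta1 `&` beta2 = set0 -> beta1 `|` beta2 = I0 ->
  (forall j, beta2 j ->
     exists (lj : 'rV[R]_n) (alpha : 'I_l -> R) (zj : 'rV[R]_m),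
       [/\ lineality TC lj,
           ggrad g j y - \sum_(i in Ip) alpha i *: ggrad g i y
             - zj *m (Jy G x y + H) + lj *m Jx G x y = 0
         & forall i, I i -> dotp (ggrad g i y) zj = 0]) ->
  (forall k, beta1 k ->
     exists (lk : 'rV[R]_n) (alpha : 'I_l -> R) (zk : 'rV[R]_m),
       [/\ lineality TC lk,
           \sum_(i in Ip) alpha i *: ggrad g i y
             + zk *m (Jy G x y + H) - lk *m Jx G x y = 0,
           forall i, (I `\ k) i -> dotp (ggrad g i y) zk = 0
         & dotp (ggrad g k y) zk = -1]) ->
  regnormal (OmegaGE G C g) z = MGE G C g x y lam beta1 beta2 /\
  MGE G C g x y lam beta1 beta2 =
    [set w *m ('J (mapF G) z)^T | w in regnormal (setDGE C g) (mapF G z)].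
Proof.
move=> z ys TC I Ip I0 K H.
move=> [dG _] _ g2 OmZ _ TD ggcq [vh mf] polyTC dirK lamK lam0 disj b12 condi condii.
have dg : differentiable g y := g2.1.1 y.
have lamM : multipliers g y ys lam.
  have [/lam0//|/lamK[v [_ _ []//]]] := pselect (K = [set 0]).
have lam_dir v mu : K v -> v != 0 -> dir_multipliers g y ys v mu ->
    forall w, K w -> dotp w (w *m lagr_hess g mu y) = dotp w (w *m H).
  move=> Kv v0 dmu w Kw.
  have [->|w0] := eqVneq w 0; first exact: etrans (dotp0l _) (esym (dotp0l _)).
  have nK : K <> [set 0].
    move=> K0; have : [set (0 : 'rV[R]_m)] v by rewrite -K0.
    by move=> /= v0'; rewrite v0' eqxx in v0.
  have [v' [Kv' v'0 dlam]] := lamK nK.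
  have dmuw : dir_multipliers g y ys w mu by rewrite -(dirK v w).
  have dlamw : dir_multipliers g y ys w lam by rewrite -(dirK v' w).
  apply/eqP; rewrite eq_le; apply/andP; split.
    exact: (dlamw.2 mu dmuw.1).
  exact: (dmuw.2 lam dlamw.1).
have tgph v vs := tangent_gph_normal g2 mf lamM lam_dir v vs.
have Kp q : K q <-> (forall i, I i -> dotp (ggrad g i y) q <= 0) /\
    (forall i, Ip i -> dotp (ggrad g i y) q = 0) := critical_coneP q dg mf lamM.
have symH : H^T = H by exact: lagr_hess_sym.
have IpI : Ip `<=` I.
  move=> i [mu muM mui]; have [_ _ mua _] := (multipliersP _ _ dg).1 muM.
  by apply: mua; rewrite gt_eqF.
have bI i : I i -> ~ Ip i -> beta1 i \/ beta2 i.
  move=> Ii nIp; have : I0 i by [].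
  by rewrite -b12.
have b0 i : beta1 i \/ beta2 i -> I i /\ ~ Ip i.
  by move=> bi; have : I0 i by rewrite -b12.
have [ys' nys' ysE] := OmZ.1.
have Cx : C x by have := OmZ.2; rewrite row_mxKl.
have nys : regnormal (Gamma g) y ys.
  have -> : ys = ys' by apply/eqP; rewrite /ys eqr_oppLR -addr_eq0 -ysE.
  by rewrite row_mxKr in nys'.
have [p [a TCE]] : exists p (a : 'I_p -> 'rV[R]_n),
    TC = [set u | forall i, dotp (a i) u <= 0].
  apply: polyhedral_cone polyTC; first exact: tangent_cone0.
  by move=> s u; exact: tangent_coneZ.
have polL : forall w, [set w | tangent_cone (setDGE C g) (mapF G z) (w *m 'J (mapF G) z)] w <->
   TC (lsubmx w) /\ complementary_graph K H (rsubmx w)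
     (- (lsubmx w *m Jx G x y + rsubmx w *m Jy G x y)).
  move=> w; rewrite /= TD /= -(hsubmxK w) mul_JmapF// !row_mxKl !row_mxKr.
  by split=> -[TCu Tg]; split=> //; exact/tgph.
(* The part of the graph attached to beta: equalities on beta, multipliers
   vanishing on the rest of I0. *)
have Kface beta (u v : 'rV[R]_m) (mu : 'I_l -> R) : beta `<=` I ->
    (forall i, (Ip `|` beta) i -> dotp (ggrad g i y) v = 0) ->
    (forall i, I i -> dotp (ggrad g i y) v <= 0) ->
    (forall i, beta i -> ~ Ip i -> 0 <= mu i) ->
    (forall i, ~ (Ip `|` beta) i -> mu i = 0) ->
    u = v *m H + \sum_i mu i *: ggrad g i y -> complementary_graph K H v u.
  move=> betaI v0 vle mu0 muE ->.
  have Kv : K v by apply/Kp; split=> // i Ipi; apply: v0; left.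
  rewrite /complementary_graph addrAC subrr add0r.
  split=> // [w /Kp[wle w0]|]; rewrite dotp_suml.
    apply: sumr_le0 => i _; rewrite dotpZl.
    have [Ipi|nIpi] := pselect (Ip i); first by rewrite w0// mulr0.
    have [bi|nbi] := pselect (beta i); last by rewrite muE ?mul0r//; case.
    by rewrite mulr_ge0_le0 ?mu0//; apply: wle; exact: betaI.
  apply: big1 => i _; rewrite dotpZl.
  have [Bi|nBi] := pselect ((Ip `|` beta) i); first by rewrite v0// mulr0.
  by rewrite muE// mul0r.
have faceM beta xi : beta `<=` I -> regnormal (OmegaGE G C g) z xi ->
    exists eta q (mu : 'I_l -> R), [/\ polar TC eta,
      lsubmx xi = eta - q *m (Jx G x y)^T,
      rsubmx xi + q *m (Jy G x y)^T + q *m H = \sum_(i in I) mu i *: ggrad g i y,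
      forall i, Ip i -> dotp (ggrad g i y) q = 0 &
      (forall i, beta i -> ~ Ip i -> dotp (ggrad g i y) q <= 0) /\
      (forall i, ~ (Ip `|` beta) i -> 0 <= mu i)].
  move=> betaI [_]; rewrite ggcq => pol.
  apply: (face_polar TCE symH IpI betaI) => u v mu TCu v0 vle mu0 muE E.
  have := pol (row_mx u v); rewrite -{1}(hsubmxK xi) dotp_row_mx; apply.
  apply/polL; rewrite row_mxKl row_mxKr; split=> //.
  exact: (Kface beta _ v mu betaI v0 vle mu0 muE E).
(* The faces of beta1 and beta2 give two representations of xi; r is the
   difference of their last components. *)
have sub1 : regnormal (OmegaGE G C g) z `<=` MGE G C g x y lam beta1 beta2.
  move=> xi nxi.
  have [i bi|eta1 [q1 [mu1 [Teta1 E1 E1' q1p [q1le mu1ge]]]]] := @faceM beta1 xi _ nxi.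
    by have [] := b0 i (or_introl bi).
  have [i bi|eta2 [q2 [mu2 [Teta2 E2 E2' q2p [q2le mu2ge]]]]] := @faceM beta2 xi _ nxi.
    by have [] := b0 i (or_intror bi).
  exists (row_mx eta1 (row_mx (rsubmx xi + q1 *m (Jy G x y)^T) q1)); last first.
    by rewrite mul_JmapFT// -E1 addrK hsubmxK.
  exists eta1, (rsubmx xi + q1 *m (Jy G x y)^T), q1; split=> //.
  exists (q1 - q2), (fun i => mu1 i - mu2 i), mu1; split.
  - split=> // [i bi|i [[Ii nIpi] nbi]]; last by apply: mu1ge => -[].
    by have [_ nIp] := b0 i (or_introl bi); exact: q1le.
  - split=> [i Ipi|i bi|i [[Ii nIpi] nbi]].
    + by rewrite dotpBr q1p// q2p// subrr.
    + rewrite dotpBr lerBrDl gerDr; apply: q2le => //.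
      by have [] := b0 i (or_intror bi).
    + by rewrite gerBl; apply: mu2ge => -[].
  - have -> : \sum_(i in I) (mu1 i - mu2 i) *: ggrad g i y =
        \sum_(i in I) mu1 i *: ggrad g i y - \sum_(i in I) mu2 i *: ggrad g i y.
      by rewrite -sumrB; apply: eq_bigr => i _; rewrite scalerBl.
    rewrite -E1' -E2' !mulmxBl -/H.
    by apply/rowP => j; move: (q1 *m _) (q1 *m _) (q2 *m _) (q2 *m _) => *; rewrite !mxE; ring.
  - exists eta2; first by split.
    have : eta1 - q1 *m (Jx G x y)^T = eta2 - q2 *m (Jx G x y)^T by rewrite -E1 -E2.
    move/eqP; rewrite subr_eq => /eqP ->; rewrite mulmxBl.
    by rewrite -addrA [LHS]addrC; congr (_ + _); rewrite addrC.
have sub2 : MGE G C g x y lam beta1 beta2 `<=`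
    [set w *m ('J (mapF G) z)^T | w in regnormal (setDGE C g) (mapF G z)].
  move=> _ [_ [eta [qs [q [-> [_ Teta] [r [mur [muq
    [[qE q0 qle muq0] [r0 qr mur_le] rE [nu [_ Tnu] etaE]]]]]]]]] <-].
  exists (row_mx eta (row_mx qs q)) => //.
  have pair lj (linj : lineality TC lj) := shift_pairing symH rE Teta Tnu etaE linj.
  have rb2 j : beta2 j -> dotp (ggrad g j y) r = 0.
    move=> /condi[lj [alpha [zj [linj eqj orthj]]]].
    have -> : ggrad g j y = \sum_(i in Ip) alpha i *: ggrad g i y +
        (zj *m (Jy G x y + H) - lj *m Jx G x y).
      move: (\sum_(i in Ip) _) (zj *m _) (lj *m _) eqj => S Z L e.
      by apply/eqP; rewrite -subr_eq0 -e; apply/eqP/rowP => i; rewrite !mxE; ring.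
    rewrite dotpDl (pair _ linj) dotp_suml !big1 ?addr0// => i.
      by rewrite inE => Ii; rewrite orthj// mulr0.
    by rewrite inE => Ipi; rewrite dotpZl r0// mulr0.
  have mub1 k : beta1 k -> mur k = 0.
    move=> bk; have [Ik nIpk] := b0 k (or_introl bk).
    have [lk [alpha [zk [link eqk orthk gk]]]] := condii k bk.
    have := dotp0l r; rewrite -eqk -addrA dotpDl (pair _ link) dotp_suml big1.
      rewrite add0r (bigD1 k) ?inE//= gk big1 ?addr0.
        by rewrite mulrN1 => /eqP; rewrite oppr_eq0 => /eqP.
      by move=> i /andP[]; rewrite inE => Ii /eqP ik; rewrite orthk ?mulr0//; split.
    by move=> i; rewrite inE => Ipi; rewrite dotpZl r0// mulr0.
  have Kq : K q.
    apply/Kp; split=> // i Ii; have [Ipi|nIpi] := pselect (Ip i); first by rewrite q0.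
    have [bi|bi] := bI i Ii nIpi; first exact: qle.
    by rewrite (le_trans (qr i bi))// rb2.
  have muq_ge i : I i -> ~ Ip i -> 0 <= muq i.
    move=> Ii nIpi; have [bi|nbi] := pselect (beta1 i); last by apply: muq0.
    rewrite -(mub1 i bi); apply: mur_le; split=> // bi2.
    by have : (beta1 `&` beta2) i by []; rewrite disj.
  split.
    by rewrite /setDGE /gph_normal /= /mapF /z !(row_mxKl, row_mxKr).
  rewrite TD => w; rewrite -(hsubmxK w) -(hsubmxK (rsubmx w)) /= row_mxKl row_mxKr.
  move: (lsubmx w) (lsubmx (rsubmx w)) (rsubmx (rsubmx w)) => u v vs [TCu /tgph[Kv vsK _]].
  rewrite !dotp_row_mx -(addr0 0) lerD//; first exact: Teta.
  (* The change of variables that turns the polar of the graph into the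
     product of the polar of K and K. *)
  have -> : dotp qs v + dotp q vs = dotp (qs + q *m H) v + dotp (vs - v *m H) q.
    by rewrite dotpDl dotpBl (dotp_mulmxl v) symH (dotpC v) (dotpC vs); ring.
  rewrite -(addr0 0) lerD//; last exact: vsK.
  rewrite qE dotp_suml; apply: sumr_le0 => i; rewrite inE => Ii; rewrite dotpZl.
  have [vle v0] := (Kp v).1 Kv.
  have [Ipi|nIpi] := pselect (Ip i); first by rewrite v0// mulr0.
  by rewrite mulr_ge0_le0 ?muq_ge ?vle.
have sub3 : [set w *m ('J (mapF G) z)^T | w in regnormal (setDGE C g) (mapF G z)]
    `<=` regnormal (OmegaGE G C g) z.
  move=> _ [w [_ pol] <-]; split=> //; rewrite ggcq => u Lu.
  by rewrite -dotp_mulmxr; exact: pol.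
by split; apply/seteqP; split=> // w; [move/sub2/sub3|move/sub3/sub1].
Qed.
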